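(* Let $G$ be a connected series-parallel graph, let $P$ be the spanning tree polytope of $G$, and let $d$ be the dimension of $P$. Then $f_0(P)f_{d-1}(P)\leq d2^{d+1}$, and equality holds if and only if $P$ is affinely isomorphic to the $d$-dimensional cube or the $d$-dimensional cross-polytope.
   Context: For a $d$-dimensional polytope $P$, $f_0(P)$ is its number of vertices and $f_{d-1}(P)$ its number of facets. Convention for $d=0$: a point has no facets, so the product is $0$, and the $0$-dimensional cube and cross-polytope are points. The $d$-dimensional cube is $[-1,1]^d$ and the $d$-dimensional cross-polytope is its polar. A finite graph is series-parallel if it has no minor isomorphic to $K_4$. The spanning tree polytope of a connected graph $G$ with edge set $E$ is the convex hull in $\mathbb{R}^E$ of the characteristic vectors of (the edge sets of) the spanning trees of $G$. *)

(* Defs.v *)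
From mathcomp Require Import all_boot all_order all_algebra finmap.
From mathcomp Require Import boolp classical_sets functions cardinality reals.

Set Implicit Arguments.
Unset Strict Implicit.
Unset Printing Implicit Defensive.

Import Order.TTheory GRing.Theory Num.Theory.
Local Open Scope ring_scope.

(* Finite undirected graphs, with loops and parallel edges allowed; the
   orientation given by [src] and [tgt] is irrelevant. *)
Record mgraph := MGraph {
  vertex : finType;
  edge : finType;
  src : edge -> vertex;
  tgt : edge -> vertex
}.

Section Graphs.
Variable G : mgraph.
Implicit Types (S : {set vertex G}) (T : {set edge G}).

Definition joins (e : edge G) (x y : vertex G) : bool :=
  ((src e == x) && (tgt e == y)) || ((src e == y) && (tgt e == x)).

Definition adjacent_in S T : rel (vertex G) :=
  fun x y => [&& x \in S, y \in S & [exists e in T, joins e x y]].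

Definition connected_in S T : Prop :=
  S != finset.set0 /\ {in S &, forall x y, connect (adjacent_in S T) x y}.

Definition connected_graph : Prop := connected_in [set: _]%SET [set: _]%SET.

(* Cycles of length 1 (loops) and 2 (pairs of parallel edges) are included. *)
Definition has_cycle T : Prop :=
  exists (k : nat) (v : 'I_k.+1 -> vertex G) (e : 'I_k.+1 -> edge G),
    [/\ injective v, injective e &
        forall i, e i \in T /\ joins (e i) (v i) (v (ordS i))].

Definition spanning_tree T : Prop :=
  connected_in [set: _]%SET T /\ ~ has_cycle T.

End Graphs.

(* [H] is isomorphic to a minor of [G]: every vertex [u] of [H] arises by
   contracting, along edges of [C], a connected branch set [B u], and every edge
   of [H] is one of the remaining edges of [G]; all else is deleted. *)
Definition minor (H G : mgraph) : Prop :=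
  exists (C : {set edge G}) (B : vertex H -> {set vertex G})
         (phi : edge H -> edge G),
    [/\ forall u, connected_in (B u) C,
        forall u w, u != w -> [disjoint B u & B w],
        injective phi &
        forall e, phi e \notin C /\
          exists x y, [/\ x \in B (src e), y \in B (tgt e) & joins (phi e) x y]].

Definition complete_graph (n : nat) : mgraph :=
  @MGraph 'I_n {p : 'I_n * 'I_n | (p.1 < p.2)%N}
    (fun e => (val e).1) (fun e => (val e).2).

Definition series_parallel (G : mgraph) : Prop := ~ minor (complete_graph 4) G.

Local Open Scope classical_set_scope.

Section Polytopes.
Variables (R : realType) (V : vectType R).
Implicit Types (A P F : set V).

Definition conv A : set V :=
  [set x | exists (n : nat) (t : 'I_n -> R) (a : 'I_n -> V),
     [/\ forall i, 0 <= t i, \sum_i t i = 1, forall i, A (a i) &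
         x = \sum_i t i *: a i]].

(* The largest [k] such that [A] contains [k.+1] affinely independent points;
   the empty set gets dimension [0]. *)
Definition affine_dim A : nat :=
  \max_(k < (\dim {: V}).+1 |
        `[< exists (x : V) (s : k.-tuple V),
              [/\ A x, forall y, y \in (s : seq V) -> A y &
                  free [seq y - x | y <- s]] >]) k.

Definition face P F : Prop :=
  exists (c : 'Hom(V, R^o)) (b : R),
    (forall x, P x -> c x <= b) /\ F = [set x | P x /\ c x = b].

Definition faces_of_dim (k : nat) P : set (set V) :=
  [set F | [/\ face P F, F !=set0 & affine_dim F = k]].

(* [fset_set] is only meaningful on finite sets, such as the set of faces of a
   polytope. *)
Definition nb_faces (k : nat) P : nat := #|` fset_set (faces_of_dim k P)|.

(* The empty face is never counted, so a point has no facets. *)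
Definition nb_facets P : nat :=
  if affine_dim P is k.+1 then nb_faces k P else 0%N.

End Polytopes.

Definition affinely_isomorphic (R : realType) (V W : vectType R)
    (P : set V) (Q : set W) : Prop :=
  exists (f : 'Hom(V, W)) (b : W), set_bij P Q (fun x => f x + b).

Section Examples.
Variable R : realType.

Definition cube (d : nat) : set {ffun 'I_d -> R^o} :=
  [set x | forall i, -1 <= x i <= 1].

Definition polar (d : nat) (A : set {ffun 'I_d -> R^o}) :
    set {ffun 'I_d -> R^o} :=
  [set y | forall x, A x -> \sum_i x i * y i <= 1].

Definition cross_polytope (d : nat) : set {ffun 'I_d -> R^o} :=
  polar (@cube d).

Definition char_vector (E : finType) (T : {set E}) : {ffun E -> R^o} :=
  [ffun e => (e \in T)%:R].

Definition spanning_tree_polytope (G : mgraph) : set {ffun edge G -> R^o} :=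
  conv [set x | exists T : {set edge G}, spanning_tree T /\ x = char_vector T].

End Examples.

Arguments cube R d : clear implicits.
Arguments cross_polytope R d : clear implicits.
Arguments spanning_tree_polytope R G : clear implicits.

(* Main.v *)
Require Import Defs.
From HB Require Import structures.
From mathcomp Require Import all_boot all_order all_algebra finmap reals.
From mathcomp Require boolp classical_sets functions cardinality.
From mathcomp Require Import lra.

Set Implicit Arguments.
Unset Strict Implicit.
Unset Printing Implicit Defensive.

(** Let [d] be the dimension of the spanning tree polytope [P]. The bound
    [d * 2 ^ d.+1] is the product of two separate bounds: [P] has at most
    [2 ^ d] vertices and at most [2 * d] facets.

    Vertices. They are 0/1 vectors in an affine space of dimension [d], and [d]
    well chosen coordinates separate the points of that space
    ([trace_coords]), so there are at most [2 ^ d] of them. If there are exactly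
    [2 ^ d], every 0/1 pattern occurs on these coordinates, and the projection
    onto them is an affine isomorphism from [P] to a cube
    ([cube_of_vertices]).

    Facets ([facet_bound]). Let [C] and [D] be sets of edges. The spanning trees
    that contain [C] and avoid [D] span a face of [P], which is, up to constant
    coordinates, the spanning tree polytope of the minor [G / C \ D]; one
    inducts over these faces. As the graph has no [K_4] minor, this minor has a
    loop, a bridge, two parallel edges or two edges in series ([sp_reducible]).
    A loop or a bridge only fixes a coordinate. If [e] and [f] are parallel or
    in series, then trees remain trees when [e] and [f] are swapped, and either
    no tree contains both or no tree avoids both. Consider the facet on which a
    functional [c] is maximal. If [c] distinguishes [e] from [f], the facet is
    one of two faces, each given by fixing the coordinate [e] or [f]; otherwise
    it is determined by its trace on the face where the coordinate [f] is fixed,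
    and this trace is a facet of that face ([facets_swappable]). That face has
    smaller dimension, so each step gains at least one dimension and at most two
    facets.

    The reduction exists by a theorem of Dirac: a finite simple graph in which
    all degrees are at least three has a [K_4] minor ([exists_K4_model]). It is
    applied to the simple graph underlying [G / C \ D].

    Equality. If the product is attained and [d > 0], then [P] has [2 ^ d]
    vertices, so it is a cube. Conversely, faces of a cube or of a
    cross-polytope pull back to faces of the same dimension of an isomorphic
    [P]. A cube provides [2 ^ d] vertices and [2 * d] facets. A cross-polytope
    provides [2 * d] vertices and [2 ^ d] facets; then the facet bound forces
    [2 ^ d <= 2 * d], hence [d <= 2] and the two numbers agree. *)

(** * Simple graphs of minimum degree three *)

Section Dirac.
Variables (W : finType) (e : rel W).
Hypotheses (esym : symmetric e) (eirr : irreflexive e).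

Definition K4_model (B : 'I_4 -> {set W}) : Prop :=
  [/\ forall i, B i != set0,
      forall i, {in B i &, forall x y, connect [rel a b | [&& a \in B i, b \in B i & e a b]] x y},
      forall i j, i != j -> [disjoint B i & B j] &
      forall i j, i != j -> exists x y, [/\ x \in B i, y \in B j & e x y]].

Lemma segment_connected (s : seq W) : sorted e s ->
  {in s &, forall x y, connect [rel a b | [&& a \in s, b \in s & e a b]] x y}.
Proof.
case: s => [|x0 s] //= ps.
have key y : y \in x0 :: s ->
    connect [rel a b | [&& a \in x0 :: s, b \in x0 :: s & e a b]] x0 y.
  rewrite inE => /orP [/eqP -> //|ys].
  have [p1 [p2 def_s]] : exists p1 p2, s = rcons p1 y ++ p2.
    by case/path.splitP: ys => p1 p2; exists p1, p2.
  apply/connectP; exists (rcons p1 y); last by rewrite last_rcons.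
  have: path e x0 (rcons p1 y) by move: ps; rewrite def_s cat_path => /andP[].
  have sub : {subset x0 :: rcons p1 y <= x0 :: s}.
    by move=> z; rewrite def_s !inE mem_cat => /orP [->//|->]; rewrite orbT.
  apply: (sub_in_path (P := mem (x0 :: s))) => [a b aP bP /= ->|].
    by rewrite andbT; apply/andP; split.
  by apply/allP.
have csym : connect_sym [rel a b | [&& a \in x0 :: s, b \in x0 :: s & e a b]].
  by apply: sym_connect_sym => a b /=; rewrite esym andbCA.
move=> x y xs ys; apply: (connect_trans (y := x0)); last exact: key.
by rewrite csym; exact: key.
Qed.

(** The four branch sets are given as paths, which makes them connected. *)
Lemma four_segments (s0 s1 s2 s3 : seq W) (x01 x10 x02 x20 x03 x30 x12 x21 x13 x31 x23 x32 : W) :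
  uniq (s0 ++ s1 ++ s2 ++ s3) ->
  sorted e s0 -> sorted e s1 -> sorted e s2 -> sorted e s3 ->
  [&& x01 \in s0, x10 \in s1 & e x01 x10] ->
  [&& x02 \in s0, x20 \in s2 & e x02 x20] ->
  [&& x03 \in s0, x30 \in s3 & e x03 x30] ->
  [&& x12 \in s1, x21 \in s2 & e x12 x21] ->
  [&& x13 \in s1, x31 \in s3 & e x13 x31] ->
  [&& x23 \in s2, x32 \in s3 & e x23 x32] ->
  exists B, K4_model B.
Proof.
move=> U S0 S1 S2 S3 E01 E02 E03 E12 E13 E23.
pose s (i : 'I_4) := nth [::] [:: s0; s1; s2; s3] i.
have ss i : sorted e (s i) by case: i => [[|[|[|[|]]]]].
have ssym i j : (exists x y, [/\ x \in s i, y \in s j & e x y]) ->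
    (exists x y, [/\ x \in s j, y \in s i & e x y]).
  by move=> [x [y [xi yj exy]]]; exists y, x; rewrite esym.
have sadj (i j : 'I_4) : (i < j)%N -> exists x y, [/\ x \in s i, y \in s j & e x y].
  move: i j => [[|[|[|[|i]]]] Hi] [[|[|[|[|j]]]] Hj] //= _; rewrite /s /=.
  - by case/and3P: E01; exists x01, x10.
  - by case/and3P: E02; exists x02, x20.
  - by case/and3P: E03; exists x03, x30.
  - by case/and3P: E12; exists x12, x21.
  - by case/and3P: E13; exists x13, x31.
  - by case/and3P: E23; exists x23, x32.
have adj i j : i != j -> exists x y, [/\ x \in s i, y \in s j & e x y].
  rewrite -(inj_eq val_inj) neq_ltn => /orP [|/sadj/ssym//]; exact: sadj.
have sdisj (i j : 'I_4) : (i < j)%N -> ~~ has (mem (s i)) (s j).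
  move: U; rewrite !cat_uniq !has_cat !negb_or.
  move=> /and3P [_ /and3P [D01 D02 D03]] /and3P [_ /andP [D12 D13] /and3P [_ D23 _]].
  by move: i j => [[|[|[|[|i]]]] Hi] [[|[|[|[|j]]]] Hj].
exists (fun i => [set x in s i]); split.
- move=> i; have [j ij] : exists j, i != j.
    by case: (eqVneq i ord0) => [->|Hi]; [exists ord_max|exists ord0].
  have [x [_ [xi _ _]]] := adj i j ij.
  by apply/set0Pn; exists x; rewrite inE.
- move=> i x y; rewrite !inE => xi yi.
  have := segment_connected (ss i) xi yi.
  rewrite (eq_connect (e' := [rel a b | [&& a \in [set x in s i],
      b \in [set x in s i] & e a b]])) // => a b /=.
  by rewrite !inE.
- move=> i j ij; apply/pred0P => x /=; rewrite !inE; apply/negP => /andP [xi xj].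
  move: ij; rewrite -(inj_eq val_inj) neq_ltn => /orP [] /sdisj /hasPn.
    by move/(_ x xj); rewrite /= xi.
  by move/(_ x xi); rewrite /= xj.
- move=> i j ij; have [x [y [xi yj exy]]] := adj i j ij.
  by exists x, y; rewrite !inE.
Qed.

(** The cycle visits [a], the end [c] of [m'], [w] and the end [u] of [Y2] in
    this order, so the chords [a w] and [c u] cross. Cutting the cycle just
    after [a], [c] and [w] yields four arcs: consecutive ones are joined by the
    cycle, opposite ones by the chords. *)
Lemma crossing_chords (a w : W) (m' Y1 Y2 : seq W) :
  m' != [::] -> Y2 != [::] ->
  let Y := Y1 ++ w :: Y2 in
  uniq (a :: m' ++ Y) -> cycle e (a :: m' ++ Y) ->
  e a w -> e (last a m') (last w Y2) -> exists B, K4_model B.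
Proof.
case: m' => // b m' _; case: Y2 => // z Y2 _ Y U.
rewrite /Y /= rcons_path !(cat_path, last_cat) /=.
move=> /and3P [ab /and5P [pm pY1 ew wz pz] lz] aw mz.
have c12 : e (last b m') (head w (Y1 ++ [:: w])).
  by case: (Y1) pY1 ew => [|h t] /=; [|case/andP].
apply: (four_segments (s0 := [:: a]) (s1 := b :: m') (s2 := Y1 ++ [:: w])
  (s3 := z :: Y2) (x01 := a) (x10 := b) (x02 := a) (x20 := w) (x03 := a)
  (x30 := last z Y2) (x12 := last b m') (x21 := head w (Y1 ++ [:: w]))
  (x13 := last b m') (x31 := last z Y2) (x23 := w) (x32 := z)) => //.
- by move: U; rewrite /Y -!catA.
- case: (Y1) pY1 ew => [|h t] //= /andP [_ pt] ew; rewrite cat_path pt /=.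
  by rewrite ew.
- by rewrite !inE !eqxx ab.
- by rewrite !inE eqxx mem_cat !inE eqxx orbT aw.
- by rewrite mem_seq1 eqxx mem_last esym.
- rewrite mem_last c12 andbT /=.
  by case: (Y1) => [|h t] /=; rewrite !inE eqxx.
- by rewrite !mem_last.
- by rewrite mem_cat !inE !eqxx orbT.
Qed.

Hypothesis deg3 : forall x y, e x y -> 2 < #|[set z | e x z]|.

(** The only use of the degree condition. *)
Lemma third_neighbour x y a b : e x y -> exists z, [/\ e x z, z != a & z != b].
Proof.
move=> exy; have := deg3 exy; rewrite (cardsD1 a) (cardsD1 b).
case: (set_0Vmem (([set z | e x z] :\ a) :\ b)) => [->|[z]].
  by rewrite cards0 addn0; do 2 case: (_ \in _).
by rewrite !inE => /and3P [zb za exz] _; exists z.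
Qed.

Lemma cycle_rev s : cycle e (rev s) = cycle e s.
Proof.
rewrite rev_cycle; apply: eq_cycle => x y; exact: esym.
Qed.

(** The state of a descent on the length of the arc [a :: m'] of a Hamiltonian
    cycle of [Z0]: a chord joins the last vertex of the arc to the vertex that
    precedes [a] on the cycle, and some Hamiltonian path of [Z0] runs through
    the arc first and ends in [zj]. The hypothesis on [Z0] then confines the
    neighbours of [a] to the cycle. A neighbour of [a] other than the two next
    to it on the cycle lies either outside the arc, where the new chord crosses
    the old one, or inside it, where it starts a shorter arc: reversing the
    initial part of the arc rotates the Hamiltonian path and gives the same
    situation again. *)
Lemma nested_chords (Z0 : seq W) (zj : W) :
  uniq Z0 ->
  (forall z0 z, perm_eq (z0 :: z) Z0 -> sorted e (z0 :: z) -> last z0 z = zj ->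
     forall y, e z0 y -> y \in Z0) ->
  forall n (a : W) (m' Y sigma : seq W),
  size m' <= n -> m' != [::] -> Y != [::] -> 
  perm_eq (a :: m' ++ Y) Z0 -> cycle e (a :: m' ++ Y) ->
  e (last a m') (last a Y) ->
  perm_eq (a :: m' ++ sigma) Z0 -> sorted e (a :: m' ++ sigma) ->
  last a (m' ++ sigma) = zj ->
  exists B, K4_model B.
Proof.
move=> uZ0 HZ; elim=> [|n IH] a m' Y sigma.
  by case: m'.
case: m' => // b m' szm _ Yn0 pZ cZ chord pS sS lS.
have eab : e a b by move: sS => /= /andP[].
have [w [eaw wb wY]] := third_neighbour b (last a Y) eab.
have: w \in Z0 by apply: (HZ _ _ pS sS lS).
rewrite -(perm_mem pZ) !(inE, mem_cat) (negbTE wb) /=.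
have -> /= : (w == a) = false by apply/negbTE/negP => /eqP wa; rewrite wa eirr in eaw.
have uZ : uniq (a :: (b :: m') ++ Y) by rewrite (perm_uniq pZ).
case/orP=> [wm|wY']; last first.
  have [Y1 [Y2 defY]] : exists Y1 Y2, Y = Y1 ++ w :: Y2.
    by case/splitPr: wY' => Y1 Y2; exists Y1, Y2.
  rewrite defY in uZ cZ chord wY.
  have Y2n0 : Y2 != [::].
    by case: (Y2) wY => //; rewrite last_cat /= eqxx.
  apply: (crossing_chords (m' := b :: m') (Y1 := Y1) (Y2 := Y2) (w := w) (a := a)) => //.
  by move: chord; rewrite last_cat.
(* The new chord is nested: the new arc is [a :: b :: m1], read backwards. *)
have [m1 [m2 defm]] : exists m1 m2, m' = m1 ++ w :: m2.
  by case/splitPr: wm => m1 m2; exists m1, m2.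
subst m'.
set T1 := a :: b :: m1.
have revT1 : rev T1 = last b m1 :: behead (rev T1).
  by rewrite /T1; case/lastP: (m1) => [|t x] //; rewrite last_rcons -!rcons_cons rev_rcons.
have lrev : last (last b m1) (behead (rev T1)) = a.
  by have := congr1 (last b) revT1; rewrite /= {1}/T1 rev_cons last_rcons.
have pZ' : perm_eq (last b m1 :: behead (rev T1) ++ (rev Y ++ rev (w :: m2))) Z0.
  rewrite -cat_cons -revT1; apply: perm_trans pZ.
  rewrite -[a :: b :: _]/((a :: b :: (m1 ++ w :: m2)) ++ Y).
  have -> : (a :: b :: (m1 ++ w :: m2)) ++ Y = T1 ++ (w :: m2 ++ Y) by rewrite /T1 /= -catA.
  apply: perm_cat; first by rewrite perm_rev.
  rewrite -rev_cat perm_rev -cat_cons //.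
apply: (IH (last b m1) (behead (rev T1)) (rev Y ++ rev (w :: m2)) (w :: m2 ++ sigma)) => //.
- rewrite size_behead size_rev /=; move: szm; rewrite /= size_cat /=.
  by rewrite addnS ltnS ; apply: leq_trans; rewrite ltnS leq_addr.
- by rewrite -size_eq0 size_behead size_rev.
- by rewrite -size_eq0 size_cat size_rev size_rev /= addnS.
- rewrite -cat_cons -revT1.
  have -> : rev T1 ++ (rev Y ++ rev (w :: m2)) =
      rot (size Y + size (w :: m2)) (rev (T1 ++ (w :: m2) ++ Y)).
    rewrite rev_cat rev_cat.
    by rewrite -(size_rev Y) -(size_rev (w :: m2)) -size_cat rot_size_cat.
  rewrite rot_cycle cycle_rev.
  by move: cZ; rewrite /T1 /= -catA.
- by rewrite lrev last_cat rev_cons last_rcons.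
- rewrite -cat_cons -revT1; apply: perm_trans pS.
  have -> : a :: (b :: m1 ++ w :: m2) ++ sigma = T1 ++ (w :: m2 ++ sigma).
    by rewrite /T1 /= -catA.
  by apply: perm_cat => //; rewrite perm_rev.
- rewrite -cat_cons -revT1 revT1 /= cat_path lrev /= eaw.
  move: sS; rewrite /= -catA cat_path /= => /and4P [_ pm1 _ pm2]; rewrite pm2 !andbT.
  have: sorted e (rev T1).
    rewrite rev_sorted /T1 /= esym eab /=.
    by rewrite (eq_path (e' := e)) // => x y; rewrite esym.
  by rewrite revT1.
- by rewrite last_cat lrev -lS /= -catA !last_cat /= ?last_cat.
Qed.


Definition good_path (s : seq W) := sorted e s && uniq s.

(** Dirac's theorem. Take a longest path; all neighbours of its first vertex lie
    on it. Among all longest paths choose one whose first vertex [a] has a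
    neighbour [y] as far along the path as possible. The path up to [y] closes
    to a cycle. Any Hamiltonian path of this cycle ending in [y] extends to a
    longest path, so by the choice of [y] its first vertex has all its
    neighbours on the cycle. A third neighbour of [a] provides the initial
    chord of the descent [nested_chords]. *)
Lemma exists_K4_model x0 y0 : e x0 y0 -> exists B, K4_model B.
Proof.
move=> e0.
pose attb (n : nat) := [exists s : n.-tuple W, good_path s].
have attP s : good_path s -> attb (size s).
  by move=> gs; apply/existsP; exists (in_tuple s).
have ex_att : exists n, attb n by exists 0; exact: (attP [::]).
have att_le n : attb n -> n <= #|W|.
  by case/existsP=> s /andP [_ /card_uniqP us]; rewrite -(size_tuple s) -us max_card.
case: (ex_maxnP ex_att att_le) => N /existsP [s0 gs0] maxN.
pose reach (j : nat) := [exists s : N.-tuple W, [exists y, good_path s &&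
    [&& y \in (s : seq W), e (head x0 s) y & index y s == j]]].
have maxs s : good_path s -> size s <= N by move/attP/maxN.
have nbr_in a p y : good_path (a :: p) -> size (a :: p) = N -> e a y -> y \in a :: p.
  move=> /andP [/= pp up] szp eay; apply/negPn/negP => yp.
  have: size (y :: a :: p) <= N.
    by apply: maxs; rewrite /good_path /= esym eay pp -/(uniq (a :: p)) yp.
  by rewrite /= -szp ltnn.
have N2 : 1 < N.
  apply: (maxs [:: x0; y0]); rewrite /good_path /= e0 inE andbT andbT.
  by apply: contraTneq e0 => ->; rewrite eirr.
have nbr a p : good_path (a :: p) -> size (a :: p) = N -> exists y, e a y.
  case: p => [|b p]; first by move=> _ N1; rewrite -N1 in N2.
  by move=> /andP [/= /andP [eab _] _] _; exists b.
have ex_reach : exists j, reach j.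
  move: (gs0) (size_tuple s0); case def_s: (tval s0) => [|a p] // gs szs.
    by rewrite -szs in N2.
  have [y eay] := nbr _ _ gs szs.
  exists (index y s0); apply/existsP; exists s0; apply/existsP; exists y.
  by rewrite gs0 eqxx def_s (nbr_in _ _ _ gs szs eay) /= eay.
have reach_le j : reach j -> j <= N.
  case/existsP=> s /existsP [y /and4P [_ ys _ /eqP <-]].
  by rewrite -[leqRHS](size_tuple s) index_size.
case: (ex_maxnP ex_reach reach_le) => j.
move=> /existsP [[s szs] /existsP [y /and4P [/= gs ys ey ij]]] maxj.
have {maxj} maxj a p z : good_path (a :: p) -> size (a :: p) = N -> e a z -> index z (a :: p) <= j.
  move=> gp szp eaz; apply: maxj; apply/existsP.
  have Hsz : size (a :: p) == N by apply/eqP.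
  exists (Tuple Hsz); apply/existsP; exists z => /=.
  by rewrite gp eqxx (nbr_in _ _ _ gp szp eaz) eaz.
(* The path is [a :: rcons q y ++ t], and [Z0] is its part up to [y]. *)
move/eqP in szs.
case: s szs gs ys ey ij => [|a p] szs gs ys ey /eqP ij; first by rewrite -szs in N2.
rewrite /= in ey.
have eay : y != a by apply: contraTneq ey => ->; rewrite eirr.
have [q [t def_p]] : exists q t, p = rcons q y ++ t.
  move: ys; rewrite inE (negbTE eay) /= => yp.
  by case/path.splitP: yp => q t; exists q, t.
have [us pp] : uniq (a :: p) /\ path e a p by case/andP: gs.
have szj : size (rcons q y) = j.
  have yq : y \notin a :: q.
    move: us; rewrite def_p -cat_cons cat_uniq => /andP [us _].
    by move: us; rewrite -rcons_cons rcons_uniq => /andP [].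
  have -> : j = index y ((a :: q) ++ y :: t) by rewrite -ij def_p cat_rcons.
  by rewrite index_cat (negbTE yq) index_head addn0 size_rcons.
set Z0 := a :: rcons q y.
have uZ0 : uniq Z0 by move: us; rewrite def_p -cat_cons cat_uniq => /andP [].
have pZ0 : path e a (rcons q y) by move: pp; rewrite def_p cat_path => /andP [].
have pt : path e y t by move: pp; rewrite def_p cat_path last_rcons => /andP [].
(* Appending the tail [t] turns a Hamiltonian path of [Z0] into a longest path. *)
have HZ z0 z : perm_eq (z0 :: z) Z0 -> sorted e (z0 :: z) -> last z0 z = y ->
    forall w, e z0 w -> w \in Z0.
  move=> pz sz lz w ew.
  have gz : good_path (z0 :: (z ++ t)).
    rewrite /good_path /= cat_path lz pt andbT; apply/andP; split=> //.
    rewrite -/(uniq (z0 :: z ++ t)) -cat_cons.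
    rewrite (perm_uniq (s2 := Z0 ++ t)) ?perm_cat2r //.
    by move: us; rewrite def_p.
  have szz : size (z0 :: z ++ t) = N.
    by rewrite -szs def_p -!cat_cons !size_cat (perm_size pz).
  have := nbr_in _ _ _ gz szz ew; rewrite -cat_cons mem_cat (perm_mem pz).
  case/orP=> // wt; have := maxj _ _ _ gz szz ew.
  case: (boolP (w \in Z0)) => // wZ.
  rewrite -cat_cons index_cat (perm_mem pz) (negbTE wZ) (perm_size pz) /= szj.
  by rewrite addSn ltnNge leq_addr.
have [b [q' def_q]] : exists b q', q = b :: q'.
  case def_q: q => [|b q']; last by exists b, q'.
  have [w [eaw wy _]] := third_neighbour y y ey.
  have := HZ _ _ (perm_refl _) pZ0 (last_rcons _ _ _) w eaw.
  by rewrite /Z0 def_q !inE (negbTE wy) orbF => /eqP wa; rewrite wa eirr in eaw.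
have [w [eaw wb wy]] := third_neighbour b y ey.
have wq : w \in q'.
  have := HZ _ _ (perm_refl _) pZ0 (last_rcons _ _ _) w eaw.
  rewrite /Z0 def_q /= !inE mem_rcons inE (negbTE wb) (negbTE wy) /=.
  by case/orP=> // /eqP wa; rewrite wa eirr in eaw.
have [q1 [q2 def_q']] : exists q1 q2, q' = q1 ++ w :: q2.
  by case/splitPr: wq => m1 m2; exists m1, m2.
set T1 := a :: b :: q1.
have revT1 : rev T1 = last b q1 :: behead (rev T1).
  by rewrite /T1; case/lastP: (q1) => [|r x] //; rewrite last_rcons -!rcons_cons rev_rcons.
have lrev : last (last b q1) (behead (rev T1)) = a.
  by have := congr1 (last b) revT1; rewrite /= {1}/T1 rev_cons last_rcons.
have defZ0 : Z0 = T1 ++ (w :: rcons q2 y).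
  by rewrite /Z0 /T1 def_q def_q' /= rcons_cat.
apply: (nested_chords (zj := y) uZ0 HZ (leqnn _) (a := last b q1) (m' := behead (rev T1))
   (Y := rev (w :: rcons q2 y)) (sigma := w :: rcons q2 y)).
- by rewrite -size_eq0 size_behead size_rev.
- by rewrite -size_eq0 size_rev.
- by rewrite -cat_cons -revT1 defZ0 perm_cat ?perm_rev.
- rewrite -cat_cons -revT1.
  have -> : rev T1 ++ rev (w :: rcons q2 y) = rot (size (w :: rcons q2 y)) (rev Z0).
    by rewrite defZ0 rev_cat -(size_rev (w :: _)) rot_size_cat.
  by rewrite rot_cycle cycle_rev /Z0 /= rcons_path pZ0 last_rcons esym.
- by rewrite lrev rev_cons last_rcons.
- by rewrite -cat_cons -revT1 defZ0 perm_cat ?perm_rev.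
- have: sorted e (rev T1) && path e w (rcons q2 y).
    move: pZ0; rewrite -[path e a _]/(sorted e Z0) defZ0 /T1 /= cat_path /=.
    move=> /and4P [eab pq _ ->]; rewrite andbT rev_sorted /= esym eab.
    by rewrite (eq_path (e' := e)) // => u v; rewrite esym.
  by rewrite revT1 /= cat_path lrev /= eaw.
- by rewrite last_cat lrev /= last_rcons.
Qed.

End Dirac.

(** * Spanning trees, exchanges and minors *)

Section Swap.
Variable E : finType.
Implicit Types (T : {set E}) (e f : E).

Definition exchange T e f := f |: (T :\ e).

(** What parallel pairs ([b = false]: no member contains both) and series pairs
    ([b = true]: no member avoids both) have in common. *)
Definition swappable (F : {set {set E}}) e f (b : bool) : Prop :=
  [/\ e != f,
      forall T, T \in F -> (e \in T) = (f \in T) -> (f \in T) = b,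
      forall T, T \in F -> e \in T -> f \notin T -> exchange T e f \in F &
      forall T, T \in F -> f \in T -> e \notin T -> exchange T f e \in F].

End Swap.

Section Trees.
Variable G : mgraph.
Local Notation V := (vertex G).
Local Notation E := (edge G).
Implicit Types (T C D : {set E}) (A : {set V}) (x y z : V) (e f g : E).

Definition connects T : rel V := connect (adjacent_in [set: V] T).

Lemma joinsC e x y : joins e x y = joins e y x.
Proof. by rewrite /joins orbC. Qed.

Lemma joins_ends e : joins e (src e) (tgt e).
Proof. by rewrite /joins !eqxx. Qed.

Lemma adjacent_inC A T : symmetric (adjacent_in A T).
Proof.
move=> x y; rewrite /adjacent_in andbCA; congr [&& _, _ & _].
by apply: eq_existsb => e; rewrite joinsC.
Qed.

Lemma connects_symmetric T : connect_sym (adjacent_in [set: V] T).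
Proof. exact: sym_connect_sym (adjacent_inC _ T). Qed.

Lemma connects_sym T x y : connects T x y = connects T y x.
Proof. exact: connects_symmetric. Qed.

Lemma connects_joins T e x y : e \in T -> joins e x y -> connects T x y.
Proof.
move=> eT exy; apply: connect1; rewrite /adjacent_in !inE /=.
by apply/existsP; exists e; rewrite eT.
Qed.

Lemma connects_edge T e : e \in T -> connects T (src e) (tgt e).
Proof. by move=> eT; apply: connects_joins (joins_ends e). Qed.

Lemma connects_trans T : transitive (connects T).
Proof. exact: connect_trans. Qed.

Lemma connects_least T (r : rel V) : reflexive r -> transitive r -> symmetric r ->
  (forall e, e \in T -> r (src e) (tgt e)) -> forall x y, connects T x y -> r x y.
Proof.
move=> rr rt rs rT x y /connectP [p]; elim: p x => [|z p IH] x /=.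
  by move=> _ ->.
move=> /andP [/and3P [_ _ /existsP [e /andP [eT exz]]] pp] ly.
apply: rt (IH z pp ly); move: exz (rT e eT).
by case/orP=> /andP [/eqP -> /eqP ->] //; rewrite rs.
Qed.

Lemma connects_sub T T' x y : (forall e, e \in T -> connects T' (src e) (tgt e)) ->
  connects T x y -> connects T' x y.
Proof.
move=> TT'; apply: connects_least TT' x y;
  [exact: connect0|exact: connects_trans|exact: connects_sym].
Qed.

Lemma connects_mono T T' x y : T \subset T' -> connects T x y -> connects T' x y.
Proof. by move=> /subsetP sTT'; apply: connects_sub => e /sTT' /connects_edge. Qed.

Lemma connects_cut T A x y :
  (forall e, e \in T -> (src e \in A) = (tgt e \in A)) ->
  connects T x y -> (x \in A) = (y \in A).
Proof.
move=> TA /(connects_least (r := fun x y => (x \in A) == (y \in A))) H.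
apply/eqP; apply: H => //.
- by move=> a b c /eqP -> /eqP ->.
- by move=> e /TA ->.
Qed.

(** A shortest connection uses the new edge at most once. *)
Lemma connects_setU1 T f x y : connects (f |: T) x y ->
  [|| connects T x y, connects T x (src f) && connects T (tgt f) y
    | connects T x (tgt f) && connects T (src f) y].
Proof.
pose r x y := [|| connects T x y, connects T x (src f) && connects T (tgt f) y
    | connects T x (tgt f) && connects T (src f) y].
apply: (connects_least (r := r)) => {x y}.
- by move=> x; rewrite /r /connects connect0.
- move=> b a c /or3P Hab /or3P Hbc; apply/or3P.
  have tr x y z : connects T x y -> connects T y z -> connects T x z by apply: connect_trans.
  case: Hab => [ab|/andP [ab ab']|/andP [ab ab']]; case: Hbc => [bc|/andP [bc bc']|/andP [bc bc']].
  + by apply: Or31; exact: tr bc.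
  + by apply: Or32; rewrite (tr _ _ _ ab bc).
  + by apply: Or33; rewrite (tr _ _ _ ab bc).
  + by apply: Or32; rewrite ab (tr _ _ _ ab' bc).
  + by apply: Or32; rewrite ab bc'.
  + by apply: Or31; exact: tr bc'.
  + by apply: Or33; rewrite ab (tr _ _ _ ab' bc).
  + by apply: Or31; exact: tr bc'.
  + by apply: Or33; rewrite ab bc'.
- move=> a b; rewrite /r connects_sym [connects T (tgt f) b]connects_sym.
  rewrite [connects T (src f) b]connects_sym [connects T a _]connects_sym.
  by rewrite [connects T a (tgt f)]connects_sym; congr (_ || _); rewrite orbC;
     congr (_ || _); rewrite andbC.
- move=> e; rewrite !inE => /orP [/eqP -> | /connects_edge]; rewrite /r; last by move=> ->.
  by rewrite /connects !connect0 orbT.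
Qed.

(** A cycle is an edge together with a path that joins its ends and avoids it.
    This turns acyclicity into a statement about the connection relation. *)
Lemma has_cycleP T :
  has_cycle T <-> exists2 g, g \in T & connects (T :\ g) (src g) (tgt g).
Proof.
split=> [[k [v [e [vinj einj He]]]]|[g gT]].
  exists (e ord_max); first by case: (He ord_max).
  set T' := T :\ _.
  (* The edges other than the last one lead from the first vertex to the last. *)
  have H (n : nat) (nk : n < k.+1) : connects T' (v ord0) (v (Ordinal nk)).
    elim: n nk => [|n IH] nk.
      have -> : Ordinal nk = ord0 by apply: val_inj.
      exact: connect0.
    have nk' : n < k.+1 by apply: ltnW.
    apply: connect_trans (IH nk') _.
    have [eT ej] := He (Ordinal nk').
    apply: (connects_joins (e := e (Ordinal nk'))).
      by rewrite !inE eT andbT (inj_eq einj) -(inj_eq val_inj) /= ltn_eqF.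
    rewrite (_ : Ordinal nk = ordS (Ordinal nk')) //.
    by apply: val_inj; rewrite /= modn_small.
  have [_ ej] := He ord_max.
  have e0 : ordS (@ord_max k) = ord0 by apply: val_inj; rewrite /= modnn.
  have := H k (ltnSn k); rewrite (_ : Ordinal _ = ord_max); last exact: val_inj.
  move: ej; rewrite e0 => /orP [] /andP [/eqP -> /eqP ->] //.
  by rewrite connects_sym.
case/connectP=> p0 pp0 lp0; case: (shortenP pp0) lp0 => p pp up _ lp {p0 pp0}.
(* A simple path from [src g] to [tgt g], closed up by [g]. *)
set x := src g in pp up lp.
pose v (i : 'I_(size p).+1) := nth x (x :: p) i.
pose P (i : nat) := [pred e | (e \in T :\ g) && joins e (nth x (x :: p) i) (nth x p i)].
pose e (i : 'I_(size p).+1) := if i < size p then odflt g [pick e | P i e] else g.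
have eP (i : 'I_(size p).+1) : i < size p -> P i (e i).
  move=> ip; rewrite /e ip; case: pickP => //= noe.
  have /(pathP x) /(_ i ip) := pp.
  case/and3P=> _ _ /existsP [h hP].
  by move: (noe h); rewrite /= hP.
have vinj : injective v.
  move=> i j /eqP; rewrite nth_uniq //; first by move/eqP/val_inj.
exists (size p), v, e; split=> //.
  move=> i j; case: (ltnP i (size p)) => [ip|ip]; case: (ltnP j (size p)) => [jp|jp].
  - have := eP i ip; have := eP j jp; rewrite /P /= => /andP [_ Hj] /andP [_ Hi] eij.
    rewrite eij in Hi; apply: val_inj => /=.
    have nu (a b : nat) : a <= size p -> b <= size p ->
        nth x (x :: p) a = nth x (x :: p) b -> a = b.
      by move=> ap bp /eqP; rewrite nth_uniq //= ?ltnS // => /eqP.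
    have S a : nth x p a = nth x (x :: p) a.+1 by [].
    move: Hi Hj; rewrite /joins !S.
    case/orP=> /andP [/eqP s1 /eqP t1] /orP [] /andP [/eqP s2 /eqP t2].
    + by rewrite s2 in s1; rewrite (nu _ _ (ltnW jp) (ltnW ip) s1).
    + rewrite s2 in s1; rewrite t2 in t1.
      have := nu _ _ jp (ltnW ip) s1; have := nu _ _ (ltnW jp) ip t1.
      by move=> -> /eqP; rewrite -addn2 -[X in _ == X]addn0 eqn_add2l.
    + rewrite s2 in s1; rewrite t2 in t1.
      have := nu _ _ (ltnW jp) ip s1; have := nu _ _ jp (ltnW ip) t1.
      by move=> <- /eqP; rewrite -addn2 -[X in X == _]addn0 eqn_add2l.
    + by rewrite s2 in s1; have := nu _ _ jp ip s1; case.
  - have := eP i ip; rewrite /P /= !inE => /andP [/andP [ig _] _] eij.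
    by move: ig; rewrite eij {1}/e ltnNge jp /= eqxx.
  - have := eP j jp; rewrite /P /= !inE => /andP [/andP [ig _] _] eij.
    by move: ig; rewrite -eij {1}/e ltnNge ip /= eqxx.
  - move=> _; apply: val_inj => /=; apply/eqP.
    by move: (ltn_ord i) (ltn_ord j); rewrite !ltnS eqn_leq => /leq_trans -> // /leq_trans ->.
move=> i; case: (ltnP i (size p)) => ip.
  have := eP i ip; rewrite /P /= !inE => /andP [/andP [_ ->] Hj]; split=> //.
  move: Hj; rewrite /v /= (_ : nth x p i = nth x (x :: p) (ordS i)) //.
  by rewrite /= modn_small.
have ei : e i = g by rewrite /e ltnNge ip.
have vi : nat_of_ord i = size p by apply/eqP; rewrite eqn_leq ip andbT -ltnS ltn_ord.
rewrite ei; split=> //; rewrite /v /= vi modnn /= nth_last /=.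
by rewrite /joins -/x eqxx; case: (p) lp => /= [->|a q ->]; rewrite ?eqxx ?orbT.
Qed.

(** A decidable form of [spanning_tree], with bridges in place of the absence of
    cycles. *)
Definition tree T : bool :=
  [forall x, forall y, connects T x y] &&
  [forall g in T, ~~ connects (T :\ g) (src g) (tgt g)].

Lemma tree_connects T x y : tree T -> connects T x y.
Proof. by case/andP=> /'forall_forallP. Qed.

Lemma tree_bridge T g : tree T -> g \in T -> ~~ connects (T :\ g) (src g) (tgt g).
Proof. by case/andP=> _ /forall_inP; apply. Qed.

Hypothesis G_conn : connected_graph G.

Lemma spanning_treeE T : spanning_tree T <-> tree T.
Proof.
rewrite /spanning_tree has_cycleP; split=> [[[_ cT] aT]|sT].
  apply/andP; split.
    by apply/'forall_forallP => x y; apply: cT; rewrite inE.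
  by apply/forall_inP => g gT; apply/negP => cg; apply: aT; exists g.
split; first by split; [case: G_conn|move=> x y _ _; exact: tree_connects].
by case=> g gT; apply/negP; exact: tree_bridge.
Qed.

(** An edge set of minimum size among those that connect all vertices. *)
Lemma tree_exists : exists T, tree T.
Proof.
pose cT T := [forall x, forall y, connects T x y].
have c0 : cT [set: E].
  by apply/'forall_forallP => x y; apply: (proj2 G_conn); rewrite inE.
case: (arg_minnP (fun T => #|T|) c0) => T cTT minT.
exists T; apply/andP; split=> //; apply/forall_inP => g gT; apply/negP => cg.
have: cT (T :\ g).
  apply/'forall_forallP => x y.
  have: connects T x y by move/'forall_forallP: cTT; apply.
  apply: connects_sub.
  move=> e eT; case: (eqVneq e g) => [-> //|eg].
  by apply: connects_edge; rewrite !inE eg.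
by move/minT; rewrite [X in X <= _](cardsD1 g) gT add1n ltnn.
Qed.

(** Removing [e] splits the tree into two sides, which [f] joins again. Every
    other edge [g] stays a bridge: a connection of the ends of [g] that avoids
    [g] would use [f], and together with [g] it would connect the ends of [f]
    without [f]. *)
Lemma tree_exchange T e f : tree T -> e \in T ->
  ~~ connects (T :\ e) (src f) (tgt f) -> tree (exchange T e f).
Proof.
move=> sT eT nf; set S := T :\ e.
have eS : T = e |: S by rewrite setD1K.
have fS : f \notin S by apply: contra nf; exact: connects_edge.
have tr x y z : connects S x y -> connects S y z -> connects S x z by apply: connect_trans.
have Sx x : connects S x (src e) || connects S x (tgt e).
  have := tree_connects x (src e) sT; rewrite eS => /connects_setU1.
  move=> /or3P [->//|/andP [->]//|/andP [->]].
  by rewrite orbT.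
apply/andP; split.
  have fe : connects (exchange T e f) (src e) (tgt e).
    have up x y : connects S x y -> connects (exchange T e f) x y.
      by apply: connects_mono; exact: subsetUr.
    have ff : connects (exchange T e f) (src f) (tgt f) by apply: connects_edge; rewrite setU11.
    case/orP: (Sx (src f)) => sf; case/orP: (Sx (tgt f)) => tf.
    - by case/negP: nf; apply: tr sf _; rewrite connects_sym.
    - apply: connect_trans (connect_trans _ ff) (up _ _ tf).
      by apply: up; rewrite connects_sym.
    - rewrite -/(connects _ _ _) connects_sym.
      apply: connect_trans (connect_trans _ ff) (up _ _ tf).
      by apply: up; rewrite connects_sym.
    - by case/negP: nf; apply: tr sf _; rewrite connects_sym.
  apply/'forall_forallP => x y; have := tree_connects x y sT.
  apply: connects_sub.
  move=> g gT; case: (eqVneq g e) => [-> //|ge].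
  by apply: connects_edge; rewrite !inE ge gT orbT.
apply/forall_inP => g; rewrite /exchange -/S in_setU1 => /orP [/eqP ->|gS].
  by rewrite setU1K.
have gf : g != f by apply: contraNneq fS => <-.
have -> : (f |: S) :\ g = f |: (S :\ g).
  by apply/setP => h; rewrite !inE; case: (eqVneq h g) => // ->; rewrite (negbTE gf).
have gT : g \in T by move: gS; rewrite !inE => /andP [].
have gnT := tree_bridge sT gT.
have gS' : connects S (src g) (tgt g) by exact: connects_edge.
have up x y : connects (S :\ g) x y -> connects S x y by apply: connects_mono; exact: subsetDl.
apply/negP => /connects_setU1 /or3P [H|/andP [H1 H2]|/andP [H1 H2]].
- case/negP: gnT; apply: connects_mono H; exact/setSD/subsetDl.
- case/negP: nf; apply: (tr _ (src g)); first by rewrite connects_sym; exact: up.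
  by apply: tr gS' _; rewrite connects_sym; exact: up.
- case/negP: nf; apply: (tr _ (tgt g)); first exact: up.
  by apply: tr _ (up _ _ H1); rewrite connects_sym.
Qed.

(** The spanning trees of [G / C \ D], each completed by the edges of [C]. *)
Definition minor_trees C D := [set T | [&& tree T, C \subset T & [disjoint T & D]]].

(** In this form of a [K_4] minor the edges to contract are those inside a
    branch set; disjointness makes the edges chosen between the sets distinct. *)
Lemma minor_K4 (B : 'I_4 -> {set V}) :
  (forall i, connected_in (B i) [set: E]) ->
  (forall i j, i != j -> [disjoint B i & B j]) ->
  (forall i j, i != j -> exists g x y, [/\ x \in B i, y \in B j & joins g x y]) ->
  minor (complete_graph 4) G.
Proof.
move=> Bc Bd Ba.
pose C := [set g | [exists u, (src g \in B u) && (tgt g \in B u)]].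
have uniqB u w x : x \in B u -> x \in B w -> u = w.
  move=> xu xw; apply/eqP; apply: contraTT xw => /Bd.
  by move/disjointFr => ->.
have Hphi (p : edge (complete_graph 4)) : exists g, exists x y,
   [/\ x \in B (src p), y \in B (tgt p) & joins g x y].
  by apply: Ba; rewrite /src /tgt /= -(inj_eq val_inj) ltn_eqF //; exact: (valP p).
have [phi Pphi] := fin_all_exists Hphi.
exists C, B, phi; split=> //.
- move=> u; have [B0 cB] := Bc u; split=> // x y xu yu.
  apply: connect_sub (cB x y xu yu) => a b /and3P [au bu /existsP [g /andP [_ gj]]].
  apply: connect1; rewrite /adjacent_in au bu /=; apply/existsP; exists g.
  rewrite gj andbT inE; apply/existsP; exists u.
  by case/orP: gj => /andP [/eqP -> /eqP ->]; rewrite au bu.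
- move=> p q pq; have [x [y [xp yp jp]]] := Pphi p; have [x' [y' [xq yq jq]]] := Pphi q.
  have lp := valP p; have lq := valP q.
  rewrite /src /tgt /= in xp yp xq yq.
  rewrite pq in jp; apply: val_inj; rewrite [val p]surjective_pairing [val q]surjective_pairing.
  move: jp jq; rewrite /joins; case/orP=> /andP [/eqP s1 /eqP t1] /orP [] /andP [/eqP s2 /eqP t2].
  + by move: xp yp; rewrite -s1 -t1 s2 t2 => /uniqB /(_ xq) -> /uniqB /(_ yq) ->.
  + move: xp yp lp; rewrite -s1 -t1 s2 t2 => /uniqB /(_ yq) -> /uniqB /(_ xq) ->.
    by move/ltnW; rewrite leqNgt lq.
  + move: xp yp lp; rewrite -s1 -t1 s2 t2 => /uniqB /(_ yq) -> /uniqB /(_ xq) ->.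
    by move/ltnW; rewrite leqNgt lq.
  + by move: xp yp; rewrite -s1 -t1 s2 t2 => /uniqB /(_ xq) -> /uniqB /(_ yq) ->.
- move=> p; split; last exact: Pphi.
  have [x [y [xp yp jp]]] := Pphi p; apply/negP; rewrite inE => /existsP [u /andP [su tu]].
  have lp := valP p; rewrite /src /tgt /= in xp yp.
  have: (val p).1 = (val p).2.
    move: jp su tu; rewrite /joins => /orP [] /andP [/eqP -> /eqP ->] /uniqB.
      by move=> /(_ _ xp) <- /uniqB /(_ yp).
    by move=> /(_ _ yp) <- /uniqB /(_ xp).
  by move=> p12; rewrite p12 ltnn in lp.
Qed.

End Trees.

(** * Reductions of a graph without K_4 minor *)

Section Reduce.
Variable G : mgraph.
Local Notation V := (vertex G).
Local Notation E := (edge G).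
Implicit Types (T : {set E}) (x y z : V) (e f g : E).
Variables (C D : {set E}).

(** A representative of the vertex of [G / C] into which a vertex of [G] is contracted. *)
Definition contract : V -> V := fingraph.root (adjacent_in [set: V] C).

Lemma contract_eq x y : (contract x == contract y) = connects C x y.
Proof. exact/fingraph.root_connect/connects_symmetric. Qed.

Lemma contract_id x : contract (contract x) = contract x.
Proof. exact/fingraph.root_root/connects_symmetric. Qed.

Lemma connects_contract x : connects C x (contract x).
Proof. by rewrite -contract_eq contract_id. Qed.

Definition free_edge g := (g \notin C) && (g \notin D).

(** The simple graph underlying [G / C \ D], on representatives. *)
Definition contracted : rel V := fun x y =>
  (x != y) && [exists g, free_edge g &&
    ((contract (src g) == x) && (contract (tgt g) == y) ||
     (contract (src g) == y) && (contract (tgt g) == x))].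

Lemma contracted_sym : symmetric contracted.
Proof.
move=> x y; rewrite /contracted eq_sym; congr (_ && _).
by apply: eq_existsb => g; rewrite orbC.
Qed.

Lemma contracted_irr : irreflexive contracted.
Proof. by move=> x; rewrite /contracted eqxx. Qed.

Lemma contracted_fixed x y : contracted x y -> contract x = x.
Proof.
case/andP=> _ /existsP [g /andP [_ /orP [] /andP [/eqP sgn /eqP tg]]].
  by rewrite -sgn contract_id.
by rewrite -tg contract_id.
Qed.

(** Branch sets are pulled back along the contraction; edges of [C] connect their fibres. *)
Lemma minor_of_contracted B : K4_model contracted B -> minor (complete_graph 4) G.
Proof.
move=> [B0 Bc Bd Ba].
pose B' i := [set z | contract z \in B i].
have Bcomp i x : x \in B i -> contract x = x.
  move=> xi; have [j ij] : exists j, i != j.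
    by case: (eqVneq i ord0) => [->|Hi]; [exists ord_max|exists ord0].
  have [a [b [ai _ ab]]] := Ba i j ij.
  case: (eqVneq x a) => [->|xa]; first exact: contracted_fixed ab.
  have /connectP [[|z p] /=] := Bc i x a xi ai.
    by move=> _ ax; rewrite ax eqxx in xa.
  by case/andP=> /and3P [_ _ /contracted_fixed].
have inside i x y : x \in B' i -> connects C x y -> connect (adjacent_in (B' i) [set: E]) x y.
  move=> xi /connectP [p]; elim: p x xi => [|z p IH] x xi /=; first by move=> _ ->.
  move=> /andP [xz pp] ly.
  have zi : z \in B' i.
    have: connects C x z by apply: connect1.
    by rewrite -contract_eq inE => /eqP <-; rewrite inE in xi.
  apply: connect_trans (IH z zi pp ly); apply: connect1.
  rewrite /adjacent_in xi zi /=; case/and3P: xz => _ _ /existsP [g /andP [_ gj]].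
  by apply/existsP; exists g; rewrite inE.
have link i j a b : a \in B i -> b \in B j -> contracted a b ->
    exists g x y, [/\ x \in B' i, contract x = a, y \in B' j, contract y = b & joins g x y].
  move=> ai bj /andP [_ /existsP [g /andP [_ /orP [] /andP [/eqP sgn /eqP tg]]]].
    by exists g, (src g), (tgt g); rewrite !inE sgn tg joins_ends.
  by exists g, (tgt g), (src g); rewrite !inE sgn tg joinsC joins_ends.
apply: (minor_K4 (B := B')).
- move=> i; split.
    have /set0Pn [x xi] := B0 i; apply/set0Pn; exists x.
    by rewrite inE (Bcomp i).
  move=> x y xi yi; rewrite inE in xi; rewrite inE in yi.
  have sub a b : connect [rel a b | [&& a \in B i, b \in B i & contracted a b]] a b ->
      a \in B i -> connect (adjacent_in (B' i) [set: E]) a b.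
    case/connectP=> p; elim: p a => [|c p IH] a /=; first by move=> _ ->.
    move=> /andP [/and3P [ai ci ac] pp] lb _.
    apply: connect_trans (IH c pp lb ci).
    have [g [u [v [ui ua vi vc guv]]]] := link i i a c ai ci ac.
    apply: connect_trans (inside i a u _ _) _.
    - by rewrite inE (Bcomp i).
    - by rewrite connects_sym -ua connects_contract.
    apply: connect_trans (inside i v c vi _); last by rewrite -vc connects_contract.
    apply: connect1; rewrite /adjacent_in ui vi /=.
    by apply/existsP; exists g; rewrite inE.
  apply: connect_trans (inside i x (contract x) _ (connects_contract x)) _; first by rewrite inE.
  apply: connect_trans (sub _ _ (Bc i _ _ xi yi) xi) _.
  by apply: inside; rewrite ?inE ?contract_id // connects_sym connects_contract.
- move=> i j /Bd; move=> H; apply/pred0P => x /=; rewrite !inE.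
  by case: (boolP (_ \in B i)) => //= /(disjointFr H).
- move=> i j /Ba [a [b [ai bj ab]]].
  have [g [x [y [xi _ yj _ gj]]]] := link i j a b ai bj ab.
  by exists g, x, y.
Qed.

Lemma free_edge_tree T g : free_edge g -> T \in minor_trees C D -> C \subset T :\ g.
Proof.
move=> /andP [gC _]; rewrite inE => /and3P [_ CT _].
by rewrite subsetD1 CT.
Qed.

Lemma minor_trees_tree T : T \in minor_trees C D -> tree T.
Proof. by rewrite inE => /and3P []. Qed.

Lemma loop_not_in T g : T \in minor_trees C D -> free_edge g ->
  contract (src g) = contract (tgt g) ->
  g \notin T.
Proof.
move=> TF fg /eqP; rewrite contract_eq => cg; apply/negP => gT.
have /negP := tree_bridge (minor_trees_tree TF) gT; apply.
by apply: connects_mono cg; exact: free_edge_tree.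
Qed.

Lemma exchange_minor_trees T e f : T \in minor_trees C D ->
  free_edge e -> free_edge f -> tree (exchange T e f) ->
  exchange T e f \in minor_trees C D.
Proof.
move=> TF /andP [eC eD] /andP [fC fD] sT; rewrite inE sT /=.
move: TF; rewrite inE => /and3P [_ CT TD]; apply/andP; split.
  apply: subset_trans (subsetUr _ _); by rewrite subsetD1 CT.
rewrite disjoint_subset; apply/subsetP => g; rewrite !inE => /orP [/eqP -> //|/andP [_ gT]].
by rewrite (disjointFr TD).
Qed.

(** Two free edges with the same ends in [G / C] connect the same vertices over
    every edge set that contains [C]. Hence one is not a bridge of a tree that
    contains the other, and one can replace the other. *)
Lemma parallel_swappable e f : e != f -> free_edge e -> free_edge f ->
  (forall S : {set E}, C \subset S -> connects S (src e) (tgt e) = connects S (src f) (tgt f)) ->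
  swappable (minor_trees C D) e f false.
Proof.
move=> ef fe ff par.
have both T : T \in minor_trees C D -> e \in T -> f \in T = false.
  move=> TF eT; apply/negP => fT.
  have /negP := tree_bridge (minor_trees_tree TF) fT; apply.
  rewrite -par; last exact: free_edge_tree TF.
  by apply: connects_edge; rewrite !inE ef.
split=> //.
- by move=> T TF eqT; case: (boolP (e \in T)) (eqT) => [/(both _ TF)|_ <-].
- move=> T TF eT fT; apply: exchange_minor_trees => //; apply: tree_exchange => //.
    exact: minor_trees_tree TF.
  rewrite -par; last exact: free_edge_tree TF.
  exact: tree_bridge (minor_trees_tree TF) eT.
- move=> T TF fT eT; apply: exchange_minor_trees => //; apply: tree_exchange => //.
    exact: minor_trees_tree TF.
  rewrite par; last exact: free_edge_tree TF.
  exact: tree_bridge (minor_trees_tree TF) fT.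
Qed.

(** The edges of the cut that separates the vertex [x] of [G / C]; loops are left out. *)
Definition incident x g := free_edge g && ((contract (src g) == x) (+) (contract (tgt g) == x)).

Lemma cut_edge T x y : T \in minor_trees C D -> contract x != contract y ->
  exists2 g, g \in T & incident (contract x) g.
Proof.
move=> TF xy.
have [/existsP [g /andP [gT gx]]|none] :=
    boolP [exists g, (g \in T) && incident (contract x) g]; first by exists g.
have: (x \in [set z | contract z == contract x]) = (y \in [set z | contract z == contract x]).
  apply: connects_cut (tree_connects x y (minor_trees_tree TF)) => g gT; rewrite !inE.
  have: ~~ incident (contract x) g.
    by apply: contra none => gx; apply/existsP; exists g; rewrite gT.
  rewrite /incident; case: (boolP (free_edge g)) => [_|nfg _] /=.
    by case: (_ == _); case: (_ == _).
  have gC : g \in C.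
    move: nfg; rewrite /free_edge negb_and !negbK => /orP [//|gD].
    by move: TF; rewrite inE => /and3P [_ _ /disjointFr /(_ gT)]; rewrite gD.
  by have /eqP -> : contract (src g) == contract (tgt g) by rewrite contract_eq connects_edge.
by rewrite !inE eqxx eq_sym (negbTE xy).
Qed.

Lemma incident_not_connects (S : {set E}) x g :
  (forall h, h \in S -> ~~ ((contract (src h) == x) (+) (contract (tgt h) == x))) ->
  incident x g -> ~~ connects S (src g) (tgt g).
Proof.
move=> noS /andP [_ gx]; apply/negP => cg.
have: (src g \in [set z | contract z == x]) = (tgt g \in [set z | contract z == x]).
  apply: connects_cut cg => h /noS; rewrite !inE.
  by case: (_ == _); case: (_ == _).
by rewrite !inE => eqg; rewrite eqg addbb in gx.
Qed.

Lemma tree_incident T x g : T \in minor_trees C D -> g \in T ->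
  (contract (src g) == x) (+) (contract (tgt g) == x) -> incident x g.
Proof.
move=> TF gT gx; rewrite /incident gx andbT /free_edge; apply/andP; split; apply/negP => gCD.
  have /eqP cg: contract (src g) == contract (tgt g) by rewrite contract_eq connects_edge.
  by rewrite cg addbb in gx.
by move: TF; rewrite inE => /and3P [_ _ /disjointFr /(_ gT)]; rewrite gCD.
Qed.

(** If the cut around a vertex of [G / C \ D] consists of [e] and [f], every
    tree meets it, and a tree that uses only one of the two may use the other
    instead. *)
Lemma series_swappable x y e f : contract x != contract y -> e != f ->
  (forall g, incident (contract x) g = (g == e) || (g == f)) ->
  swappable (minor_trees C D) e f true.
Proof.
move=> xy ef inc.
have [ie jf] : incident (contract x) e /\ incident (contract x) f by rewrite !inc !eqxx orbT.
have fe : free_edge e by case/andP: ie.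
have ff : free_edge f by case/andP: jf.
split=> //.
- move=> T TF; have [g gT] := cut_edge TF xy; rewrite inc => /orP [] /eqP gg; subst g.
    by rewrite gT => <-.
  by [].
- move=> T TF eT fT; apply: exchange_minor_trees => //; apply: tree_exchange => //.
    exact: minor_trees_tree TF.
  apply: incident_not_connects jf => h; rewrite !inE => /andP [he hT].
  apply/negP => /(tree_incident TF hT); rewrite inc (negbTE he) => /eqP hf.
  by rewrite -hf hT in fT.
- move=> T TF fT eT; apply: exchange_minor_trees => //; apply: tree_exchange => //.
    exact: minor_trees_tree TF.
  apply: incident_not_connects ie => h; rewrite !inE => /andP [hf hT].
  apply/negP => /(tree_incident TF hT); rewrite inc (negbTE hf) orbF => /eqP he.
  by rewrite -he hT in eT.
Qed.

(** If there is neither a loop nor a parallel pair, the edges at a vertex of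
    [G / C \ D] correspond to its neighbours. Dirac's theorem excludes that all
    vertices with a neighbour have at least three neighbours, so some vertex has exactly
    one edge, a bridge, or exactly two, a series pair. *)
Theorem sp_reducible f0 : series_parallel G -> free_edge f0 ->
  exists2 f, free_edge f &
    [\/ forall T, T \in minor_trees C D -> f \notin T,
        forall T, T \in minor_trees C D -> f \in T |
        exists e b, swappable (minor_trees C D) e f b].
Proof.
move=> sp ff0.
have [/existsP [g /andP [fg /eqP lg]]|noloop] :=
    boolP [exists g, free_edge g && (contract (src g) == contract (tgt g))].
  by exists g => //; apply: Or31 => T TF; exact: loop_not_in.
have {}noloop g : free_edge g -> contract (src g) != contract (tgt g).
  by move=> fg; apply: contra noloop => lg; apply/existsP; exists g; rewrite fg.
pose par e f := (contract (src e) == contract (src f)) && (contract (tgt e) == contract (tgt f)) ||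
                (contract (src e) == contract (tgt f)) && (contract (tgt e) == contract (src f)).
have [/existsP [e /existsP [f /and4P [fe ff ef pef]]]|nopar] :=
    boolP [exists e, exists f, [&& free_edge e, free_edge f, e != f & par e f]].
  exists f => //; apply: Or33; exists e, false; apply: parallel_swappable => // S CS.
  have up u v : connects C u v -> connects S u v by apply: connects_mono.
  move: pef; rewrite /par !contract_eq => /orP [] /andP [/up s1 /up s2].
    rewrite /connects (same_connect (connects_symmetric _) s1).
    rewrite [LHS](connects_symmetric) [RHS](connects_symmetric).
    by rewrite (same_connect (connects_symmetric _) s2).
  rewrite /connects (same_connect (connects_symmetric _) s1) [LHS](connects_symmetric).
  by rewrite (same_connect (connects_symmetric _) s2).
have {}nopar e f : free_edge e -> free_edge f -> par e f -> e = f.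
  move=> fe ff pef; apply/eqP; apply: contraNT nopar => ef.
  by apply/existsP; exists e; apply/existsP; exists f; rewrite fe ff ef pef.
have [/existsP [x /existsP [y /andP [xy low]]]|high] :=
    boolP [exists x, exists y, contracted x y && (#|[set z | contracted x z]| <= 2)].
  have cx := contracted_fixed xy.
  have cy : contract y = y by move: xy; rewrite contracted_sym => /contracted_fixed.
  have ncxy : contract x != contract y by rewrite cx cy; case/andP: xy.
  (* [oth g] is the other end of an edge [g] at [x]. *)
  pose oth g := if contract (src g) == x then contract (tgt g) else contract (src g).
  pose N := [set g | incident x g].
  have oth_inj : {in N &, injective oth}.
    move=> e f; rewrite !inE => /andP [fe ie] /andP [ff jf] oef.
    apply: nopar => //; move: oef ie jf; rewrite /par /oth.
    case: (eqVneq (contract (src e)) x) => [->|se];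
      case: (eqVneq (contract (src f)) x) => [->|sf] /=.
    - by move=> ->; rewrite !eqxx.
    - by move=> -> _ /eqP ->; rewrite !eqxx ?orbT.
    - by move=> -> /eqP -> _; rewrite !eqxx orbT.
    - by move=> -> /eqP -> /eqP ->; rewrite !eqxx.
  have N2 : #|N| <= 2.
    rewrite -(card_in_imset oth_inj); apply: leq_trans low; apply: subset_leq_card.
    apply/subsetP => z /imsetP [g]; rewrite !inE => /andP [fg ig] ->.
    rewrite /contracted /oth; have := noloop g fg; move: ig.
    case: (eqVneq (contract (src g)) x) => [sgn|sgn] /=.
      rewrite sgn => _ ->; apply/existsP; exists g; by rewrite fg sgn !eqxx.
    move/eqP=> tg _; rewrite eq_sym sgn; apply/existsP; exists g.
    by rewrite fg tg !eqxx orbT.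
  have [f fN] : exists f, f \in N.
    case/andP: (xy) => nxy /existsP [g /andP [fg gxy]]; exists g; rewrite inE /incident fg /=.
    by move: gxy; case/orP=> /andP [/eqP -> /eqP ->]; rewrite eqxx [y == x]eq_sym (negbTE nxy).
  have ff : free_edge f by move: fN; rewrite inE => /andP [].
  exists f => //.
  have [D0|[e]] := set_0Vmem (N :\ f).
    apply: Or32 => T TF; have [g gT] := cut_edge TF ncxy; rewrite cx => ig.
    have: g \notin N :\ f by rewrite D0 inE.
    by rewrite !inE ig andbT negbK => /eqP <-.
  rewrite !inE => /andP [ef ie].
  apply: Or33; exists e, true; apply: (series_swappable ncxy ef) => g; rewrite cx.
  have NE : [set e; f] = N.
    apply/eqP; rewrite eqEcard cards2 ef N2 andbT; apply/subsetP => h.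
    by rewrite !inE => /orP [] /eqP -> //; rewrite inE in fN.
  by have := in_set2 g e f; rewrite NE inE.
case: sp; have [B HB] : exists B, K4_model contracted B; last exact: minor_of_contracted HB.
apply: (exists_K4_model contracted_sym contracted_irr _
  (x0 := contract (src f0)) (y0 := contract (tgt f0))).
  move=> x y xy; rewrite ltnNge; apply: contra high => low.
  by apply/existsP; exists x; apply/existsP; exists y; rewrite xy.
rewrite /contracted noloop //; apply/existsP; exists f0.
by rewrite ff0 !eqxx.
Qed.

End Reduce.

(** * Affine dimension and faces of a convex hull *)

Import boolp classical_sets functions cardinality.
Import Order.TTheory GRing.Theory Num.Theory.
Local Open Scope ring_scope.
Local Open Scope classical_set_scope.

Section AffineDim.
Variables (R : realType) (V : vectType R).
Implicit Types (A B F : set V) (x y : V) (U : {vspace V}).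

(** The dimension of a nonempty set is that of its direction space, the least
    space [U] containing all differences with a fixed base point. All facts about
    [affine_dim] below are drawn from this. *)
Lemma affine_dimP A x0 : A x0 -> exists U,
  [/\ \dim U = affine_dim A, forall y, A y -> y - x0 \in U &
      forall U', (forall y, A y -> y - x0 \in U') -> (U <= U')%VS].
Proof.
move=> Ax0.
pose Q (k : nat) := exists (x : V) (s : k.-tuple V),
  [/\ A x, forall y, y \in (s : seq V) -> A y & free [seq y - x | y <- s]].
have Q0 : Q 0%N.
  by exists x0, [tuple]; split=> //; rewrite /free span_nil dimv0.
have [k /asboolP Hk maxk] : exists2 k : 'I_(\dim {: V}).+1, `[<Q k>] & affine_dim A = k.
  have pos : (0 < #|[pred k : 'I_(\dim {: V}).+1 | `[<Q k>]]|)%N.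
    by apply/card_gt0P; exists ord0; apply/asboolP.
  by have [k Qk Ek] := eq_bigmax_cond (fun k : 'I_(\dim {: V}).+1 => k : nat) pos; exists k.
have Qle n : Q n -> (n <= affine_dim A)%N.
  move=> Qn; have nV : (n < (\dim {: V}).+1)%N.
    case: (Qn) => x [s [_ _ fs]]; rewrite ltnS.
    move: fs; rewrite /free size_map size_tuple => /eqP <-.
    exact/dimvS/subvf.
  rewrite /affine_dim.
  apply: (@leq_bigmax_cond _ (fun k : 'I_(\dim {: V}).+1 => `[<Q k>])
    (fun k => k : nat) (Ordinal nV)).
  exact/asboolP.
case: Hk => x [s [Ax As fs]].
set X := [seq y - x | y <- s] in fs.
have HX y : A y -> y - x \in <<X>>%VS.
  move=> Ay; apply/negPn/negP => yX.
  have: Q k.+1.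
    exists x, [tuple of y :: s]; split=> //.
      by move=> z; rewrite inE => /orP [/eqP ->|/As].
    by rewrite /= free_cons yX.
  by move/Qle; rewrite maxk ltnn.
exists <<X>>%VS; split.
- by move: fs; rewrite /free size_map size_tuple maxk => /eqP.
- move=> y Ay; rewrite (_ : y - x0 = (y - x) - (x0 - x)); last by rewrite opprB addrA subrK.
  by rewrite rpredB ?HX.
- move=> U' HU'; apply/span_subvP => v /mapP [y /As Ay ->].
  rewrite (_ : y - x = (y - x0) - (x - x0)); last by rewrite opprB addrA subrK.
  by rewrite rpredB ?HU'.
Qed.

Lemma affine_dim_le A x0 U : A x0 -> (forall y, A y -> y - x0 \in U) ->
  (affine_dim A <= \dim U)%N.
Proof.
by move=> Ax0 AU; have [W [<- _ Wmin]] := affine_dimP Ax0; exact/dimvS/Wmin.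
Qed.

Lemma affine_dim_leS A B x0 v : B `<=` A -> B x0 ->
  (forall y, A y -> exists2 z, B z & y - z \in <[v]>%VS) ->
  (affine_dim A <= (affine_dim B).+1)%N.
Proof.
move=> BA Bx0 AB; have [W [dW BW _]] := affine_dimP Bx0.
apply: (@leq_trans (\dim (W + <[v]>)%VS)).
  apply: (affine_dim_le (BA _ Bx0)) => y /AB [z /BW zW yz].
  by rewrite (_ : y - x0 = (z - x0) + (y - z)) ?memv_add // [RHS]addrC subrKA.
apply: leq_trans (dimv_add_leqif _ _) _; rewrite dW -addn1 leq_add2l dim_vline.
by case: (_ != _).
Qed.

(** A subset of full dimension has the same direction space, so a functional
    that is constant on it is constant throughout. This is what makes proper
    faces drop in dimension, and faces of equal dimension coincide once nested. *)
Lemma affine_dim_const A F x0 (c : 'Hom(V, R^o)) b : F `<=` A -> F x0 ->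
  (affine_dim A <= affine_dim F)%N -> (forall x, F x -> c x = b) ->
  forall x, A x -> c x = b.
Proof.
move=> FA Fx0 dAF Fc.
have [W [dW AW _]] := affine_dimP (FA _ Fx0).
have [U [dU FU Umin]] := affine_dimP Fx0.
have UW : (U <= W)%VS by apply: Umin => y /FA /AW.
have eUW : U = W by apply/eqP; rewrite eqEdim UW dU dW.
have Uc : (U <= lker c)%VS.
  by apply: Umin => y Fy; rewrite memv_ker linearB /= !Fc // subrr.
move=> x Ax; have : x - x0 \in lker c by apply: (subvP Uc); rewrite eUW AW.
by rewrite memv_ker linearB /= (Fc _ Fx0) subr_eq0 => /eqP.
Qed.

Lemma affine_dim0 A x0 : A x0 -> (forall x, A x -> x = x0) -> affine_dim A = 0%N.
Proof.
move=> Ax0 A1; apply/eqP; rewrite -leqn0 -[leqRHS](dimv0 V).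
by apply: (affine_dim_le Ax0) => y /A1 ->; rewrite subrr mem0v.
Qed.

Lemma affine_dim0_eq A x0 : A x0 -> affine_dim A = 0%N -> forall x, A x -> x = x0.
Proof.
move=> Ax0 A0 x Ax; have [W [dW AW _]] := affine_dimP Ax0.
move: (AW x Ax); rewrite A0 in dW; move/eqP: dW; rewrite dimv_eq0 => /eqP ->.
by rewrite memv0 subr_eq0 => /eqP.
Qed.

End AffineDim.

Section Hull.
Variables (R : realType) (V : vectType R) (I : finType) (p : I -> V).
Implicit Types (B S : {set I}) (F : set V).

Lemma conv_sum (J : finType) (A : set V) (t : J -> R) (a : J -> V) :
  (forall j, 0 <= t j) -> \sum_j t j = 1 -> (forall j, A (a j)) ->
  conv A (\sum_j t j *: a j).
Proof.
move=> t0 t1 Aa; exists #|J|, (fun i => t (enum_val i)), (fun i => a (enum_val i)).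
split=> //.
  by rewrite -t1 [RHS](reindex_onto enum_val enum_rank) //=;
    [apply: eq_bigl => i; rewrite enum_valK eqxx | move=> j _; rewrite enum_rankK].
by rewrite [LHS](reindex_onto enum_val enum_rank) //=;
    [apply: eq_bigl => i; rewrite enum_valK eqxx | move=> j _; rewrite enum_rankK].
Qed.

Lemma conv_incl (A : set V) x : A x -> conv A x.
Proof.
move=> Ax; have -> : x = \sum_(i < 1) 1 *: x by rewrite big_ord1 scale1r.
by apply: (conv_sum (t := fun=> 1)) => //; rewrite ?big_ord1.
Qed.

Definition hull B : set V := conv [set x | exists T, T \in B /\ x = p T].

Lemma hull_vertex B T : T \in B -> hull B (p T).
Proof. by move=> TB; apply: conv_incl; exists T. Qed.

Lemma hullP B x : hull B x -> exists n (t : 'I_n -> R) (T : 'I_n -> I),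
  [/\ forall i, 0 <= t i, \sum_i t i = 1, forall i, T i \in B & x = \sum_i t i *: p (T i)].
Proof.
move=> [n [t [a [t0 t1 Aa ->]]]].
have /choice [T HT] : forall i, exists T, T \in B /\ a i = p T by move=> i; exact: Aa.
exists n, t, T; split=> //; first by move=> i; case: (HT i).
by apply: eq_bigr => i _; case: (HT i) => _ ->.
Qed.

Lemma hull_sum (J : finType) B (t : J -> R) (T : J -> I) :
  (forall j, 0 <= t j) -> \sum_j t j = 1 -> (forall j, T j \in B) ->
  hull B (\sum_j t j *: p (T j)).
Proof. by move=> t0 t1 TB; apply: conv_sum => // j; exists (T j). Qed.

Lemma hull_mono B B' : (B \subset B')%SET -> hull B `<=` hull B'.
Proof.
move=> /fintype.subsetP BB' x /hullP [n [t [T [t0 t1 TB ->]]]].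
by apply: hull_sum => // i; exact: BB'.
Qed.

Lemma hull_nonempty B : hull B !=set0 -> exists T, T \in B.
Proof.
case=> x /hullP [[|n] [t [T [_ t1 TB _]]]]; last by exists (T ord0).
by move: t1; rewrite big_ord0 => /eqP; rewrite eq_sym oner_eq0.
Qed.

Lemma hull_diff B x0 (U : {vspace V}) : (forall T, T \in B -> p T - x0 \in U) ->
  forall y, hull B y -> y - x0 \in U.
Proof.
move=> BU y /hullP [n [t [T [t0 t1 TB ->]]]].
have -> : x0 = \sum_i t i *: x0 by rewrite -scaler_suml t1 scale1r.
rewrite -sumrB rpred_sum // => i _.
by rewrite -scalerBr rpredZ // BU.
Qed.

Lemma hull_le B (c : 'Hom(V, R^o)) b : (forall T, T \in B -> c (p T) <= b) ->
  forall y, hull B y -> c y <= b.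
Proof.
move=> Bc y /hullP [n [t [T [t0 t1 TB ->]]]].
rewrite linear_sum /= -[b]mul1r -t1 mulr_suml ler_sum // => i _.
by rewrite linearZ /= ler_wpM2l // Bc.
Qed.

Lemma hull_eq B (c : 'Hom(V, R^o)) b : (forall T, T \in B -> c (p T) = b) ->
  forall y, hull B y -> c y = b.
Proof.
move=> Bc y /hullP [n [t [T [t0 t1 TB ->]]]].
rewrite linear_sum /= -[b]mul1r -t1 mulr_suml; apply: eq_bigr => i _.
by rewrite linearZ /= Bc.
Qed.

(** A convex combination reaches the maximum of [c] only if every point with a
    positive weight does. *)
Lemma face_vertex_hull B (c : 'Hom(V, R^o)) b (S := [set T in B | c (p T) == b]%SET) :
  (forall T, T \in B -> c (p T) <= b) ->
  [set x | hull B x /\ c x = b] = hull S.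
Proof.
move=> Bc; apply/seteqP; split=> [x [/hullP [n [t [T [t0 t1 TB ->]]]]]|x Sx] /=; last first.
  split; first by apply: hull_mono Sx; apply/fintype.subsetP => T; rewrite inE => /andP [].
  by apply: hull_eq Sx => T; rewrite inE => /andP [_ /eqP].
rewrite linear_sum /= => cb.
have tight i : t i != 0 -> T i \in S.
  move=> ti; rewrite inE TB /= eq_le Bc //=.
  have Hi j : 0 <= t j * (b - c (p (T j))) by rewrite mulr_ge0 // subr_ge0 Bc.
  have : \sum_j t j * (b - c (p (T j))) = 0.
    under eq_bigr do rewrite mulrBr.
    rewrite sumrB -mulr_suml t1 mul1r; apply/eqP; rewrite subr_eq0; apply/eqP.
    by rewrite -{1}cb; apply: eq_bigr => j _; rewrite linearZ.
  move/eqP; rewrite psumr_eq0; last by move=> j _; exact: Hi.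
  move/allP => /(_ i (mem_index_enum i)) /=; rewrite mulf_eq0 (negbTE ti) /= subr_eq0.
  by move/eqP ->.
have [i0 ti0] : exists i, t i != 0.
  apply/existsP; apply: contraT; rewrite negb_exists => /forallP H.
  move: t1; rewrite big1 => [/eqP|i _]; first by rewrite eq_sym oner_eq0.
  by apply/eqP; rewrite -[_ == _]negbK.
(* Points of weight zero need not be in [S]; [T i0] takes their place. *)
have -> : \sum_i t i *: p (T i) = \sum_i t i *: p (if t i == 0 then T i0 else T i).
  by apply: eq_bigr => i _; case: eqP => // ->; rewrite !scale0r.
apply: hull_sum => // i; case: ifPn; last exact: tight.
by move=> _; exact: tight.
Qed.

Lemma face_hull B F : face (hull B) F -> F = hull [set T in B | `[< F (p T) >]].
Proof.
move=> [c [b [cb FE]]].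
have Bc T : T \in B -> c (p T) <= b by move/hull_vertex; exact: cb.
rewrite {1}FE face_vertex_hull //; congr hull; apply/setP => T; rewrite !inE.
case: (boolP (T \in B)) => //= TB; apply/eqP/asboolP; rewrite FE.
  by split=> //; exact: hull_vertex.
by case.
Qed.

Lemma face_hull_intro B (c : 'Hom(V, R^o)) b :
  (forall T, T \in B -> c (p T) <= b) ->
  face (hull B) [set x | hull B x /\ c x = b].
Proof. by move=> Bc; exists c, b; split=> //; exact: hull_le. Qed.

(** By [face_hull] a face is determined by the points [p T] that it contains.
    Finiteness makes [nb_faces] the actual number of faces. *)
Lemma finite_faces B k : finite_set (faces_of_dim k (hull B)).
Proof.
apply: (@sub_finite_set _ _ (hull @` [set: {set I}])); last exact/finite_image/finite_finset.
move=> F [/face_hull -> _ _]; by eexists.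
Qed.

End Hull.

(** * The facet bound *)

Section Count.
Variable T : choiceType.
Implicit Types (A C : set T).

Lemma count_mono A C : finite_set C -> A `<=` C ->
  (#|` fset_set A| <= #|` fset_set C|)%N.
Proof.
move=> finC AC; apply: fsubset_leq_card.
by rewrite -fset_set_sub //; exact: sub_finite_set finC.
Qed.

Lemma count_image (J : finType) (S : {set J}) (h : J -> T) :
  (#|` fset_set (h @` [set` S])| <= #|S|)%N.
Proof.
apply: (@leq_trans #|` [fset x in [seq h j | j <- enum S]]%fset|).
  apply: fsubset_leq_card; apply/fsubsetP => x.
  rewrite in_fset_set; last exact: finite_image.
  rewrite inE => -[j Sj <-]; rewrite inE; apply/mapP; exists j => //.
  by rewrite mem_enum.
by rewrite card_fseq; apply: leq_trans (size_undup _) _; rewrite size_map -cardE.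
Qed.

Lemma count_inj (J : finType) (h : J -> T) A : injective h -> finite_set A ->
  (forall j, A (h j)) -> (#|J| <= #|` fset_set A|)%N.
Proof.
move=> hinj finA hA.
apply: (@leq_trans #|` [fset x in [seq h j | j <- enum J]]%fset|).
  have uJ : uniq [seq h j | j <- enum J] by rewrite map_inj_uniq // enum_uniq.
  by rewrite card_fseq (undup_id uJ) size_map -cardT.
apply: fsubset_leq_card; apply/fsubsetP => x; rewrite inE => /mapP [j _ ->].
by rewrite in_fset_set // inE.
Qed.

Lemma count_cover (U : choiceType) (C : set U) (h : U -> T) A x y : finite_set C ->
  (forall a, A a -> [\/ a = x, a = y | exists2 c, C c & a = h c]) ->
  (#|` fset_set A| <= (#|` fset_set C|).+2)%N.
Proof.
move=> finC AC.
have finD : finite_set ([set x] `|` [set y] `|` (h @` C)).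
  by rewrite !finite_setU; split; [split; exact: finite_set1|exact: finite_image].
apply: (leq_trans (count_mono finD _)).
  by move=> a /AC [->|->|[c Cc ->]]; [left; left|left; right|right; exists c].
rewrite !fset_setU ?finite_setU //; do ?[split|exact: finite_set1|exact: finite_image].
rewrite !fset_set1 fset_set_image //.
apply: leq_trans (leq_card_fsetU _ _) _; rewrite -add2n leq_add //.
  by apply: leq_trans (leq_card_fsetU _ _) _; rewrite !cardfs1.
exact: leq_imfset_card.
Qed.

End Count.

Section Facets.
Variables (R : realType) (V : vectType R).
Implicit Types (P F : set V).

(** Unlike [nb_facets], this needs no case distinction: a point has no facets. *)
Definition facets P : set (set V) :=
  [set F | [/\ face P F, F !=set0 & (affine_dim F).+1 = affine_dim P]].

Lemma nb_facetsE P : nb_facets P = #|` fset_set (facets P)|.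
Proof.
rewrite /nb_facets /nb_faces; case dP: (affine_dim P) => [|k].
  rewrite (_ : facets P = set0) ?fset_set0 ?cardfs0 //.
  by rewrite -subset0 => F [_ _]; rewrite dP.
congr #|` fset_set _|; apply/seteqP; split=> F [FP F0 dF]; split=> //.
  by rewrite dP dF.
by move: dF; rewrite dP => -[].
Qed.

Lemma finite_facets (I : finType) (p : I -> V) B : finite_set (facets (hull p B)).
Proof.
apply: (sub_finite_set _ (finite_faces p B (affine_dim (hull p B)).-1)).
by move=> F [FP F0 <-]; split.
Qed.

End Facets.

Section Coord.
Variables (R : realType) (E : finType).
Local Notation W := {ffun E -> R^o}.

Definition coord (e : E) (x : W) : R^o := x e.

Lemma coord_is_linear e : linear (coord e).
Proof. by move=> a x y; rewrite /coord !ffunE. Qed.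
HB.instance Definition _ e :=
  GRing.isLinear.Build R W R^o *:%R (coord e) (coord_is_linear e).

Definition coordl e : 'Hom(W, R^o) := linfun (coord e).

Lemma coordlE e x : coordl e x = x e.
Proof. by rewrite lfunE. Qed.

Lemma char_exchange (T : {set E}) e f : e \in T -> f \notin T ->
  char_vector R (exchange T e f) = char_vector R T - char_vector R [set e] + char_vector R [set f].
Proof.
move=> eT fT; apply/ffunP => g; rewrite !ffunE /exchange !inE.
have [->|gf] := eqVneq g f.
  have -> : (f == e) = false by apply: contraNF fT => /eqP ->.
  by rewrite (negbTE fT) subr0 add0r.
have [->|ge] := eqVneq g e; first by rewrite eT /= subrr addr0.
by rewrite subr0 addr0.
Qed.

Lemma char_coord (T : {set E}) g (b : bool) : (char_vector R T g == b%:R) = ((g \in T) == b).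
Proof. by rewrite ffunE; case: (g \in T); case: b; rewrite ?eqxx ?oner_eq0 // eq_sym oner_eq0. Qed.

Local Notation P := (hull (@char_vector R E)).

Section Swappable.
Variables (B : {set {set E}}) (e f : E) (b : bool) (T0 : {set E}).
Implicit Type T : {set E}.
Hypotheses (swB : swappable B e f b) (T0B : T0 \in B) (T0f : (f \in T0) != b).

(** Swaps [e] and [f], if necessary, to bring a member of [B] into the part where
    [f] is fixed. *)
Definition switch T :=
  if (f \in T) == b then T else if f \in T then exchange T f e else exchange T e f.
Definition fixed_part := [set T in B | (f \in T) == b].

Lemma unbalanced_partner T : T \in B -> (f \in T) != b -> (e \in T) = ~~ (f \in T).
Proof.
move=> TB; case: swB => _ H _ _; apply: contraNeq => efT.
have /(H T TB) -> // : (e \in T) = (f \in T).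
by move: efT; case: (e \in T); case: (f \in T).
Qed.

Lemma switch_fixed_part T : T \in B -> switch T \in fixed_part.
Proof.
move=> TB; rewrite inE /switch; case: ifPn => fT; first by rewrite TB.
have eT := unbalanced_partner TB fT; case: swB => ef _ swe swf.
case: (boolP (f \in T)) => fT'; rewrite fT' in eT; last first.
  by rewrite swe ?eT // /exchange !inE eqxx /=; move: fT; rewrite (negbTE fT'); case: (b).
rewrite swf ?eT // /exchange !inE eqxx (eq_sym f) (negbTE ef) /=.
by move: fT; rewrite fT'; case: (b).
Qed.

Lemma switch_functional (c : 'Hom(W, R^o)) T : T \in B ->
  c (char_vector R [set e]) = c (char_vector R [set f]) ->
  c (char_vector R (switch T)) = c (char_vector R T).
Proof.
move=> TB cef; rewrite /switch; case: ifPn => // fT; have eT := unbalanced_partner TB fT.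
case: (boolP (f \in T)) => fT'; rewrite fT' in eT; rewrite char_exchange ?eT //.
  by rewrite linearD linearB /= cef subrK.
by rewrite linearD linearB /= cef subrK.
Qed.

Lemma switch_diff T : T \in B ->
  char_vector R T - char_vector R (switch T) \in
    <[char_vector R [set e] - char_vector R [set f]]>%VS.
Proof.
move=> TB; rewrite /switch; case: ifPn => fT; first by rewrite subrr mem0v.
have eT := unbalanced_partner TB fT.
case: (boolP (f \in T)) => fT'; rewrite fT' in eT; rewrite char_exchange ?eT //.
  rewrite opprD opprB addrA addrCA subrr addr0 -memvN opprB memv_line //.
by rewrite opprD opprB addrA addrCA subrr addr0 memv_line.
Qed.

Lemma fixed_part_sub : P fixed_part `<=` P B.
Proof. by apply: hull_mono; apply/fintype.subsetP => T; rewrite inE => /andP []. Qed.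

(** [T0] is a vertex outside the face given by the fixed coordinate [f]. *)
Lemma fixed_part_dim : (affine_dim (P fixed_part) < affine_dim (P B))%N.
Proof.
rewrite ltnNge; apply/negP => dle.
have H : forall x, P fixed_part x -> coordl f x = b%:R.
  by apply: hull_eq => T; rewrite inE coordlE -char_coord => /andP [_ /eqP].
have := affine_dim_const fixed_part_sub (hull_vertex _ (switch_fixed_part T0B))
  dle H (hull_vertex _ T0B).
by move/eqP; rewrite coordlE char_coord (negbTE T0f).
Qed.

(** Recovers a facet that treats [e] and [f] alike from its trace on the fixed
    part. *)
Definition unfold_face (A : set W) : set W :=
  P [set T in B | `[< A (char_vector R (switch T)) >]].

Definition side g : set W := [set x | P B x /\ coordl g x = b%:R].

(** A facet inside a proper face is that face, by comparison of dimensions. *)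
Lemma facet_side F g (c : 'Hom(W, R^o)) beta : facets (P B) F ->
  F = [set x | P B x /\ c x = beta] ->
  (exists2 T, T \in B & (g \in T) != b) ->
  (forall T, T \in B -> c (char_vector R T) <= beta) ->
  (forall T, T \in B -> c (char_vector R T) = beta -> (g \in T) == b) ->
  F = side g.
Proof.
move=> [_ [x0 Fx0] dF] FE [T1 T1B T1g] cB opt.
have Fsub : F `<=` side g.
  rewrite {1}FE face_vertex_hull // => x Sx; split.
    by apply: hull_mono Sx; apply/fintype.subsetP => T; rewrite inE => /andP [].
  apply: hull_eq Sx => T; rewrite inE coordlE => /andP [TB /eqP /(opt T TB)].
  by rewrite -char_coord => /eqP.
have dside : (affine_dim (side g) < affine_dim (P B))%N.
  rewrite ltnNge; apply/negP => dle.
  have sP : side g `<=` P B by move=> x [].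
  have sc : forall x, side g x -> coordl g x = b%:R by move=> x [].
  have := affine_dim_const sP (Fsub _ Fx0) dle sc (hull_vertex _ T1B).
  by move/eqP; rewrite coordlE char_coord (negbTE T1g).
apply/seteqP; split=> // x sx; rewrite FE; split; first by case: sx.
rewrite -dF ltnS in dside.
apply: (affine_dim_const Fsub Fx0 dside _ sx) => y; by rewrite FE => -[].
Qed.

(** As [c] does not distinguish [e] from [f], switching does not change its
    value. Hence [F] projects along one direction onto its trace [F'], whose
    dimension is therefore at least that of [F] minus one. On the other hand [F']
    is a proper face of the fixed part, as otherwise [F] would be all of [P B],
    and the fixed part has smaller dimension than [P B]. So [F'] is a facet. *)
Lemma facet_unfold F (c : 'Hom(W, R^o)) beta : facets (P B) F ->
  F = [set x | P B x /\ c x = beta] ->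
  (forall T, T \in B -> c (char_vector R T) <= beta) ->
  c (char_vector R [set e]) = c (char_vector R [set f]) ->
  exists2 F', facets (P fixed_part) F' & F = unfold_face F'.
Proof.
move=> [faceF F0 dF] FE cB cef.
pose F' := [set x | P fixed_part x /\ c x = beta].
have cB' T : T \in fixed_part -> c (char_vector R T) <= beta.
  by rewrite inE => /andP [/cB].
have swF T : T \in B -> F (char_vector R T) <-> F' (char_vector R (switch T)).
  move=> TB; rewrite FE /F' /= switch_functional //; split=> [[_ ?]|[_ ?]]; split=> //.
    exact/hull_vertex/switch_fixed_part.
  exact/hull_vertex.
have FS := face_hull faceF.
have [T1] : exists T, T \in [set T in B | `[< F (char_vector R T) >]].
  by apply: (@hull_nonempty _ _ _ (@char_vector R E)); rewrite -FS.
rewrite inE => /andP [T1B /asboolP T1F].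
have F'T1 : F' (char_vector R (switch T1)) by apply/swF.
have dF' : (affine_dim F <= (affine_dim F').+1)%N.
  apply: (affine_dim_leS (v := char_vector R [set e] - char_vector R [set f]) _ F'T1).
    by move=> x [/fixed_part_sub Bx cx]; rewrite FE.
  move=> y; rewrite FE face_vertex_hull // => /hullP [n [t [T [t0 t1 TS ->]]]].
  have TB i : T i \in B by move: (TS i); rewrite inE => /andP [].
  exists (\sum_i t i *: char_vector R (switch (T i))).
    rewrite /F' face_vertex_hull //; apply: hull_sum => // i.
    move: (TS i); rewrite inE [in X in _ -> X]inE switch_fixed_part // => /andP [_].
    by rewrite switch_functional.
  rewrite -sumrB rpred_sum // => i _.
  by rewrite -scalerBr rpredZ // switch_diff.
have dF'2 : (affine_dim F' < affine_dim (P fixed_part))%N.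
  rewrite ltnNge; apply/negP => dle.
  have H : forall x, P fixed_part x -> c x = beta.
    have s : F' `<=` P fixed_part by move=> x [].
    by apply: (affine_dim_const s F'T1 dle) => x [].
  have FP : F = P B.
    rewrite FE; apply/seteqP; split=> [x []|x Bx] //; split=> //.
    apply: hull_eq Bx => T TB; rewrite -switch_functional //; apply: H.
    exact/hull_vertex/switch_fixed_part.
  by have /eqP := dF; rewrite FP eqn_leq ltnn.
exists F'; last first.
  rewrite FS /unfold_face; congr hull; apply/setP => T; rewrite !inE.
  case: (boolP (T \in B)) => //= TB.
  by apply/asboolP/asboolP; rewrite swF.
split; [exact: face_hull_intro|by exists (char_vector R (switch T1))|].
apply/eqP; rewrite eqn_leq dF'2 /= -ltnS -ltnS.
by apply: leq_ltn_trans fixed_part_dim _; rewrite -dF ltnS.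
Qed.

Lemma exchange_beats T g h (c : 'Hom(W, R^o)) beta :
  g \in T -> h \notin T -> c (char_vector R (exchange T g h)) <= beta ->
  c (char_vector R [set g]) < c (char_vector R [set h]) ->
  c (char_vector R T) != beta.
Proof.
move=> gT hT; rewrite char_exchange // linearD linearB /= => le lt.
rewrite lt_eqF //; apply: lt_le_trans le.
by rewrite -addrA ltrDl addrC subr_gt0.
Qed.

(** If [c] is larger at [f] than at [e], no optimal member contains [e] without
    [f], since an exchange would gain. With the property of pairs in [B], this
    fixes the coordinate [f] of optimal members to [b] if [b] holds, and the
    coordinate [e] otherwise. The opposite case is symmetric. *)
Lemma facets_swappable : (nb_facets (P B) <= (nb_facets (P fixed_part)).+2)%N.
Proof.
rewrite !nb_facetsE.
apply: (count_cover (h := unfold_face) (x := side e) (y := side f)); first exact: finite_facets.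
move=> F FF; have [[c [beta [cP FE]]] _ _] := FF.
have cB T : T \in B -> c (char_vector R T) <= beta by move=> TB; apply/cP/hull_vertex.
case: (swB) => ef both swe swf.
have eT0 := unbalanced_partner T0B T0f.
have sf : exists2 T, T \in B & (f \in T) != b by exists T0.
have se : exists2 T, T \in B & (e \in T) != b.
  have T0f' := T0f.
  case: (boolP (f \in T0)) => fT0; rewrite ?fT0 ?(negbTE fT0) in eT0 T0f'.
    exists (exchange T0 f e); first by rewrite swf ?eT0.
    by rewrite /exchange !inE eqxx /=.
  exists (exchange T0 e f); first by rewrite swe ?eT0.
  by rewrite /exchange !inE eqxx (negbTE ef) /=.
case: (ltgtP (c (char_vector R [set e])) (c (char_vector R [set f]))) => [lt|lt|eq].
- have bad T : T \in B -> c (char_vector R T) = beta -> e \in T -> f \in T.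
    move=> TB /eqP cT eT; apply: contraLR cT => fT.
    by apply: exchange_beats lt => //; apply/cB/swe.
  case: (boolP b) => hb.
    apply: Or32; apply: (facet_side FF FE sf cB) => T TB /(bad T TB) imp.
    rewrite hb; apply/eqP; case: (boolP (f \in T)) => // fT.
    by rewrite -hb -(both T TB) ?(negbTE fT) //; apply/negbTE; apply: contra fT.
  apply: Or31; apply: (facet_side FF FE se cB) => T TB /(bad T TB) imp.
  rewrite (negbTE hb); apply/eqP/negbTE/negP => eT.
  by move: hb; rewrite -(both T TB) imp.
- have bad T : T \in B -> c (char_vector R T) = beta -> f \in T -> e \in T.
    move=> TB /eqP cT fT; apply: contraLR cT => eT.
    by apply: exchange_beats lt => //; apply/cB/swf.
  case: (boolP b) => hb.
    apply: Or31; apply: (facet_side FF FE se cB) => T TB /(bad T TB) imp.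
    rewrite hb; apply/eqP; case: (boolP (e \in T)) => // eT.
    have fT : f \in T = false by apply/negbTE; apply: contra eT.
    by rewrite -hb -(both T TB) fT // (negbTE eT).
  apply: Or32; apply: (facet_side FF FE sf cB) => T TB /(bad T TB) imp.
  rewrite (negbTE hb); apply/eqP/negbTE/negP => fT.
  by move: hb; rewrite -(both T TB) fT // imp.
- apply: Or33; exact: facet_unfold FF FE cB eq.
Qed.

End Swappable.
End Coord.

Section FacetBound.
Variables (R : realType) (G : mgraph).
Local Notation P := (hull (@char_vector R (edge G))).
Implicit Types (C D T : {set edge G}).

Lemma fixed_part_minor_trees C D f b :
  fixed_part (minor_trees C D) f b =
    if b then minor_trees (f |: C)%SET D else minor_trees C (f |: D)%SET.
Proof.
apply/setP => T; rewrite inE; case: b; rewrite !inE.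
  rewrite finset.subUset finset.sub1set -!andbA.
  by case: (f \in T); rewrite ?andbF //= ?andbT ?eqxx.
have -> : [disjoint T & (f |: D)%SET]%B = (f \notin T) && [disjoint T & D]%B.
  rewrite [LHS]disjoint_sym finset.disjoints_subset finset.subUset finset.sub1set inE.
  by rewrite -finset.disjoints_subset disjoint_sym.
by case: (f \in T); rewrite ?andbF //= ?andbT.
Qed.

(** Induction on the number of edges that are neither in [C] nor in [D]. If the
    coordinate of the chosen edge [f] is constant on the trees, it moves to [C]
    or [D] without changing them; otherwise [facets_swappable] applies. *)
Lemma facet_bound C D T0 : series_parallel G -> T0 \in minor_trees C D ->
  (nb_facets (P (minor_trees C D)) <= 2 * affine_dim (P (minor_trees C D)))%N.
Proof.
move=> sp; have [n] := ubnP #|[set g | free_edge C D g]|%SET.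
elim: n C D T0 => // n IH C D T0; rewrite ltnS => szn T0F.
have [/existsP [f0 ff0]|none] := boolP [exists g, free_edge C D g]; last first.
  have F1 T : T \in minor_trees C D -> T = C.
    rewrite inE => /and3P [_ CT TD]; apply/eqP; rewrite finset.eqEsubset CT andbT.
    apply/fintype.subsetP => g gT; apply: contraNT none => gC; apply/existsP; exists g.
    by rewrite /free_edge gC (disjointFr TD gT).
  rewrite /nb_facets (_ : affine_dim _ = 0%N) //.
  apply: (affine_dim0 (hull_vertex _ T0F)) => x Hx; apply/eqP; rewrite -subr_eq0 -memv0.
  apply: hull_diff Hx => T TF; by rewrite (F1 _ TF) (F1 _ T0F) subrr mem0v.
have [f ff red] := sp_reducible sp ff0.
have [b family_or] : exists b, (minor_trees C D = fixed_part (minor_trees C D) f b) \/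
    (exists2 e, swappable (minor_trees C D) e f b &
       exists2 T, T \in minor_trees C D & (f \in T) != b).
  have whole b : (forall T, T \in minor_trees C D -> (f \in T) == b) ->
      minor_trees C D = fixed_part (minor_trees C D) f b.
    move=> H; apply/setP => T; rewrite [RHS]inE.
    by case: (boolP (T \in minor_trees C D)) => // TF; rewrite (H T TF).
  case: red => [no|yes|[e [b swp]]].
  - by exists false; left; apply: whole => T /no /negbTE ->.
  - by exists true; left; apply: whole => T /yes ->.
  - exists b; have [/existsP [T /andP [TF fT]]|all] :=
      boolP [exists T, (T \in minor_trees C D) && ((f \in T) != b)].
      by right; exists e => //; exists T.
    left; apply: whole => T TF; apply: contraNT all => fT.
    by apply/existsP; exists T; rewrite TF.
have IHb T : T \in fixed_part (minor_trees C D) f b ->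
    (nb_facets (P (fixed_part (minor_trees C D) f b)) <=
     2 * affine_dim (P (fixed_part (minor_trees C D) f b)))%N.
  rewrite fixed_part_minor_trees.
  case: b {family_or} => TF; apply: (IH _ _ T) => //; apply: leq_trans szn.
    apply: proper_card; apply/properP; split.
      apply/fintype.subsetP => g; rewrite !inE /free_edge !inE.
      by rewrite negb_or -andbA => /and3P [_ -> ->].
    by exists f; rewrite !inE // /free_edge !inE eqxx.
  apply: proper_card; apply/properP; split.
    by apply/fintype.subsetP => g; rewrite !inE /free_edge !inE negb_or => /and3P [-> _ ->].
  by exists f; rewrite !inE // /free_edge !inE eqxx andbF.
case: family_or => [eqF|[e swp [T TF fT]]]; first by rewrite eqF in T0F *; exact: IHb T0F.
apply: leq_trans (facets_swappable _ swp TF fT) _.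
have := IHb _ (switch_fixed_part swp TF); have := fixed_part_dim R swp TF fT.
move=> dlt le; apply: (@leq_trans (2 * (affine_dim (P (fixed_part (minor_trees C D) f b))).+1)).
  by rewrite mulnS -[X in (X <= _)%N]add2n leq_add2l.
by rewrite leq_pmul2l.
Qed.

End FacetBound.

(** * Vertices of 0/1 polytopes *)

Section ZeroOne.
Variables (R : realType) (E : finType).
Local Notation W := {ffun E -> R^o}.
Local Notation P := (hull (@char_vector R E)).
Implicit Types (B : {set {set E}}) (T : {set E}).

(** A nonzero vector of [U] has a nonzero coordinate; those vectors of [U] on
    which it vanishes form a smaller space. *)
Lemma separating_coords (U : {vspace W}) : exists2 h : seq E, (size h <= \dim U)%N &
  forall u, u \in U -> (forall g, g \in h -> u g = 0) -> u = 0.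
Proof.
have [n] := ubnP (\dim U); elim: n U => // n IH U; rewrite ltnS => dU.
have [U0|U0] := eqVneq U 0%VS.
  by exists [::] => // u; rewrite U0 memv0 => /eqP.
have [g ug] : exists g, vpick U g != 0.
  apply/existsP; apply: contraNT U0; rewrite negb_exists => /forallP H.
  rewrite -vpick0; apply/eqP/ffunP => g; rewrite ffunE; apply/eqP.
  by have := H g; rewrite negbK.
have lt : (\dim (U :&: lker (coordl R g)) < \dim U)%N.
  rewrite ltn_neqAle (dimvS (capvSl _ _)) andbT; apply: contraNneq ug => eqd.
  have : vpick U \in (U :&: lker (coordl R g))%VS.
    suff -> : (U :&: lker (coordl R g))%VS = U by exact: memv_pick.
    by apply/eqP; rewrite eqEdim capvSl eqd /=.
  by rewrite memv_cap memv_ker coordlE => /andP [_].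
have [h sh Hh] := IH _ (leq_trans lt dU).
exists (g :: h); first exact: leq_ltn_trans lt.
move=> u uU u0; apply: Hh; last by move=> k kh; apply: u0; rewrite inE kh orbT.
by rewrite memv_cap uU memv_ker coordlE u0 ?eqxx ?mem_head.
Qed.

Lemma char_inj : injective (@char_vector R E).
Proof.
move=> S T eqST; apply/setP => g; have /eqP := congr1 (fun x : W => x g) eqST.
rewrite [X in _ == X]ffunE => /eqP H; apply/eqP; rewrite -(char_coord R) H.
by case: (g \in T).
Qed.

Definition trace (h : seq E) T : {ffun 'I_(size h) -> bool} :=
  [ffun i => tnth (in_tuple h) i \in T].

Lemma trace_coords B T0 : T0 \in B -> exists h : seq E,
  [/\ (size h <= affine_dim (P B))%N, {in B &, injective (trace h)} &
      forall x y, P B x -> P B y -> (forall g, g \in h -> x g = y g) -> x = y].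
Proof.
move=> T0B; have [U [dU BU _]] := affine_dimP (hull_vertex (@char_vector R E) T0B).
have [h sh Hh] := separating_coords U.
have inj x y : P B x -> P B y -> (forall g, g \in h -> x g = y g) -> x = y.
  move=> /BU xU /BU yU xy; apply/eqP; rewrite -subr_eq0; apply/eqP; apply: Hh.
    rewrite (_ : x - y = (x - char_vector R T0) - (y - char_vector R T0)).
      by rewrite rpredB.
    by rewrite opprB addrA subrK.
  by move=> g gh; rewrite !ffunE xy // subrr.
exists h; split=> //; first by rewrite -dU.
move=> S T SB TB eST; apply: char_inj; apply: inj; try exact: hull_vertex.
move=> g gh; have /tnthP [i ->] : g \in in_tuple h by []. rewrite !ffunE.
by have := congr1 (fun t : {ffun _ -> _} => t i) eST; rewrite !ffunE => ->.
Qed.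

Lemma vertices_le B T0 : T0 \in B -> (#|B| <= 2 ^ affine_dim (P B))%N.
Proof.
move=> /trace_coords [h [sh hinj _]].
rewrite -(card_in_imset hinj); apply: leq_trans (max_card _) _.
by rewrite card_ffun card_bool card_ord leq_pexp2l.
Qed.

Lemma nb_vertices_le B : (nb_faces 0 (P B) <= #|B|)%N.
Proof.
apply: leq_trans (count_image B (fun T => [set char_vector R T])).
apply: count_mono; first exact: finite_image.
move=> F [faceF F0 dF]; have FE := face_hull faceF.
have [T] : exists T, T \in [set T in B | `[< F (char_vector R T) >]].
  by apply: (@hull_nonempty _ _ _ (@char_vector R E)); rewrite -FE.
rewrite inE => /andP [TB /asboolP FT]; exists T => //.
by apply/seteqP; split=> x /= => [->//|]; exact: affine_dim0_eq FT dF x.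
Qed.

Lemma char_bounds B x : P B x -> forall g, 0 <= x g <= 1.
Proof.
move=> /hullP [n [t [T [t0 t1 TB ->]]]] g; rewrite sum_ffunE.
under eq_bigr do rewrite ffunE.
apply/andP; split.
  by rewrite sumr_ge0 // => i _; rewrite mulr_ge0 // ffunE; case: (_ \in _).
rewrite -t1 ler_sum // => i _; rewrite -[leRHS]mulr1 ler_wpM2l // ffunE.
by case: (_ \in _).
Qed.

(** The weights of the product measure on the vertices of [[0, 1]^n] with mean
    [y]. *)
Lemma product_weights n (y : 'I_n -> R) (w : {ffun 'I_n -> bool} -> R) :
  (forall g, w g = \prod_i (if g i then y i else 1 - y i)) ->
  \sum_g w g = 1 /\ forall i, \sum_g w g * (g i)%:R = y i.
Proof.
move=> wE; split.
  under eq_bigr do rewrite wE.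
  rewrite -(bigA_distr_bigA (fun i (b : bool) => if b then y i else 1 - y i)) big1 // => i _.
  by rewrite big_bool /= addrC subrK.
move=> i.
pose F k (b : bool) := (if b then y k else 1 - y k) * (if k == i then b%:R else 1).
have -> : \sum_g w g * (g i)%:R = \sum_(g : {ffun 'I_n -> bool}) \prod_k F k (g k).
  apply: eq_bigr => g _; rewrite wE big_split /=; congr (_ * _).
  by rewrite (bigD1 i) //= eqxx big1 ?mulr1 // => k /negbTE ->.
rewrite -(bigA_distr_bigA F) (bigD1 i) //= [X in _ * X]big1 => [|k ki].
  by rewrite big_bool /F eqxx /= !mulr1 mulr0 addr0.
by rewrite big_bool /F (negbTE ki) /= !mulr1 addrC subrK.
Qed.

(** The separating coordinates embed [P B] affinely into the cube. All 0/1
    patterns on them are attained by members of [B], so every point of the cube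
    is attained by the product combination of these members. *)
Lemma cube_of_vertices B T0 : T0 \in B -> (2 ^ affine_dim (P B) <= #|B|)%N ->
  affinely_isomorphic (P B) (cube R (affine_dim (P B))).
Proof.
move=> T0B; have [h [sh hinj Hsep]] := trace_coords T0B => full.
have szh : size h = affine_dim (P B).
  apply/eqP; rewrite eqn_leq sh /= -(@leq_exp2l 2) //; apply: leq_trans full _.
  rewrite -(card_in_imset hinj); apply: leq_trans (max_card _) _.
  by rewrite card_ffun card_bool card_ord.
rewrite -szh in full *.
have surj : forall g : {ffun 'I_(size h) -> bool}, exists T, T \in B /\ trace h T = g.
  have : trace h @: B = [set: _]%SET.
    apply/eqP; rewrite eqEcard finset.subsetT /= (card_in_imset hinj).
    by rewrite cardsT card_ffun card_bool card_ord.
  by move=> /setP eqT g; have := eqT g; rewrite inE => /imsetP [T TB ->]; exists T.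
have /choice [T HT] := surj.
have TB g : T g \in B by case: (HT g).
have Ttr g i : (tnth (in_tuple h) i \in T g) = g i.
  by case: (HT g) => _ /(congr1 (fun t : {ffun _ -> _} => t i)); rewrite ffunE.
pose fl (x : W) : {ffun 'I_(size h) -> R^o} := [ffun i => 2 * x (tnth (in_tuple h) i)].
have fl_lin : linear fl.
  by move=> a x y; apply/ffunP => i; rewrite !ffunE mulrDr mulrCA.
pose fL := GRing.isLinear.Build R W {ffun 'I_(size h) -> R^o} *:%R fl fl_lin.
pose flL : {linear W -> {ffun 'I_(size h) -> R^o}} := HB.pack fl fL.
pose m1 : {ffun 'I_(size h) -> R^o} := [ffun=> -1].
exists (linfun flL), m1.
have fE x i : (linfun flL x + m1) i = 2 * x (tnth (in_tuple h) i) - 1.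
  by rewrite lfunE /= !ffunE.
split.
- move=> x /char_bounds Hx i; have /andP [H0 H1] := Hx (tnth (in_tuple h) i).
  rewrite fE; apply/andP; split.
    by rewrite -[leLHS]add0r lerD2r mulr_ge0.
  by rewrite lerBlDr -[leRHS]/(2%:R) ler_piMr.
- move=> x y; rewrite !inE => Px Py /addIr exy; apply: Hsep => // g gh.
  have /tnthP [i ->] : g \in in_tuple h by [].
  have := congr1 (fun z : {ffun _ -> _} => z i) exy; rewrite !lfunE /= !ffunE.
  by apply: mulfI; rewrite pnatr_eq0.
move=> y cy; pose z i := (y i + 1) / 2.
have z0 i : 0 <= z i.
  by have /andP [H _] := cy i; rewrite divr_ge0 // -lerBlDr sub0r.
have z1 i : 0 <= 1 - z i.
  have /andP [_ H] := cy i; rewrite subr_ge0 ler_pdivrMr // mul1r -[leRHS]/(1 + 1).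
  by rewrite lerD2r.
pose w (g : {ffun 'I_(size h) -> bool}) := \prod_i (if g i then z i else 1 - z i).
have [w1 wz] := product_weights (fun g => erefl (w g)).
exists (\sum_g w g *: char_vector R (T g)).
  by apply: hull_sum => // g; apply: prodr_ge0 => i _; case: (g i).
apply/ffunP => i; rewrite fE sum_ffunE.
have -> : \sum_g (w g *: char_vector R (T g)) (tnth (in_tuple h) i) = z i.
  by rewrite -wz; apply: eq_bigr => g _; rewrite !ffunE Ttr.
by rewrite /z mulrC divfK ?pnatr_eq0 // addrK.
Qed.

End ZeroOne.

(** * Cubes, cross-polytopes and equality *)

Section Dot.
Variables (R : realType) (d : nat).
Local Notation W := {ffun 'I_d -> R^o}.

Definition dot (a : 'I_d -> R) (y : W) : R^o := \sum_i a i * y i.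

Lemma dot_is_linear a : linear (dot a).
Proof.
move=> k x y; rewrite /dot scaler_sumr -big_split /=; apply: eq_bigr => i _.
by rewrite !ffunE mulrDr [in RHS]/GRing.scale /= mulrCA.
Qed.
HB.instance Definition _ a :=
  GRing.isLinear.Build R W R^o *:%R (dot a) (dot_is_linear a).

Definition dotl a : 'Hom(W, R^o) := linfun (dot a).

Lemma dotlE a y : dotl a y = \sum_i a i * y i.
Proof. by rewrite lfunE. Qed.

Definition unitv (k : 'I_d) : W := [ffun i => (i == k)%:R].

Lemma dot_unitl k y : dotl (fun i => (i == k)%:R) y = y k.
Proof.
rewrite dotlE (bigD1 k) //= eqxx mul1r big1 ?addr0 // => i /negbTE ->.
by rewrite mul0r.
Qed.

Lemma dot_scaled k s y : dotl (fun i => s * (i == k)%:R) y = s * y k.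
Proof. by rewrite -dot_unitl !dotlE mulr_sumr; apply: eq_bigr => i _; rewrite mulrA. Qed.

Lemma dim_unitv (U : {vspace W}) : (forall k, unitv k \in U) -> (d <= \dim U)%N.
Proof.
move=> HU; suff -> : U = fullv.
  by rewrite dimvf /dim /= card_ord muln1.
apply/eqP; rewrite eqEsubv subvf /=; apply/subvP => y _.
have -> : y = \sum_k y k *: unitv k.
  apply/ffunP => i; rewrite sum_ffunE (bigD1 i) //= big1 => [|k ki].
    by rewrite !ffunE eqxx addr0 /GRing.scale /= mulr1.
  by rewrite !ffunE eq_sym (negbTE ki) scaler0.
by rewrite rpred_sum // => k _; rewrite rpredZ.
Qed.

End Dot.

Section Pullback.
Variables (R : realType) (V : vectType R) (d : nat).
Local Notation W := {ffun 'I_d -> R^o}.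
Variables (P : set V) (Q : set W) (f : 'Hom(V, W)) (b : W).
Hypotheses (iso : set_bij P Q (fun x => f x + b))
  (finP : forall k, finite_set (faces_of_dim k P)).

Definition pullback (c : 'Hom(W, R^o)) (beta : R) : set V :=
  [set x | P x /\ c (f x + b) = beta].

Lemma pullback_onto y : Q y -> exists2 x, P x & f x + b = y.
Proof. by case: iso => _ _ onto /onto [x Px <-]; exists x. Qed.

Lemma lin_shift (c : 'Hom(W, R^o)) x : c (f x + b) = (c \o f)%VF x + c b :> R.
Proof. by rewrite comp_lfunE linearD. Qed.

Lemma pullback_face (c : 'Hom(W, R^o)) beta :
  (forall y, Q y -> c y <= beta) -> face P (pullback c beta).
Proof.
move=> cQ; exists (c \o f)%VF, (beta - c b); split.
  move=> x Px; rewrite lerBrDr -lin_shift; apply: cQ.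
  by case: iso => into _ _; exact: into.
apply/seteqP; split=> x [Px cx]; split=> //.
  by apply/eqP; rewrite eq_sym subr_eq -lin_shift cx.
by rewrite lin_shift cx subrK.
Qed.

(** Distinctness is asked for on [Q], where it can be checked on explicit
    points. *)
Lemma pullback_count (J : finType) (c : J -> 'Hom(W, R^o)) (beta : J -> R) k :
  (forall j y, Q y -> c j y <= beta j) ->
  (forall j, exists2 y, Q y & c j y = beta j) ->
  (forall i j, (forall y, Q y -> c i y = beta i <-> c j y = beta j) -> i = j) ->
  (forall j, affine_dim (pullback (c j) (beta j)) = k) ->
  (#|J| <= nb_faces k P)%N.
Proof.
move=> cQ ne inj dk.
apply: (count_inj (h := fun j => pullback (c j) (beta j))) => //.
  move=> i j eij; apply: inj => y Qy; have [x Px <-] := pullback_onto Qy.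
  have sub i' j' : pullback (c i') (beta i') = pullback (c j') (beta j') ->
      c i' (f x + b) = beta i' -> c j' (f x + b) = beta j'.
    move=> eij' ci; have : pullback (c j') (beta j') x by rewrite -eij'.
    by case.
  by split; apply: sub.
move=> j; split; [exact/pullback_face/cQ| |exact: dk].
have [y Qy cy] := ne j; have [x Px fx] := pullback_onto Qy.
by exists x; split; rewrite ?fx.
Qed.

Lemma pullback_point (c : 'Hom(W, R^o)) beta y : Q y -> c y = beta ->
  (forall z, Q z -> c z = beta -> z = y) -> affine_dim (pullback c beta) = 0%N.
Proof.
move=> Qy cy uniq; have [x Px fx] := pullback_onto Qy.
apply: (@affine_dim0 _ _ _ x) => [|x' [Px' cx']]; first by split; rewrite ?fx.
case: iso => into inj _; apply: inj; rewrite ?inE //.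
by rewrite fx; apply: uniq => //; exact: into.
Qed.

(** The upper bound holds because the face is proper. For the lower bound, the
    images of the directions of the face, together with one coordinate vector
    [unitv R i], span the whole space. *)
Lemma pullback_facet (c : 'Hom(W, R^o)) beta i y0 : affine_dim P = d ->
  Q y0 -> c y0 = beta -> (exists2 y, Q y & c y != beta) ->
  (forall k, exists y s t, [/\ Q y, c y = beta &
      unitv R k = s *: (y - y0) + t *: unitv R i]) ->
  affine_dim (pullback c beta) = d.-1.
Proof.
move=> dP Qy0 cy0 [y1 Qy1 cy1] units.
have [x0 Px0 fx0] := pullback_onto Qy0; have [x1 Px1 fx1] := pullback_onto Qy1.
have Ax0 : pullback c beta x0 by split; rewrite ?fx0.
apply/eqP; rewrite eqn_leq; apply/andP; split.
  rewrite -ltnS (leq_trans _ (leqSpred _)) // ltnNge -[X in (X <= _)%N]dP; apply/negP => dle.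
  have sub : pullback c beta `<=` P by move=> x [].
  have H x : pullback c beta x -> (c \o f)%VF x = beta - c b.
    by move=> [_ <-]; rewrite lin_shift addrK.
  have := affine_dim_const sub Ax0 dle H Px1.
  move/eqP; rewrite eq_sym subr_eq -lin_shift fx1 eq_sym.
  by rewrite (negbTE cy1).
have [U [<- AU _]] := affine_dimP Ax0.
rewrite -subn1 leq_subLR addnC.
apply: (@leq_trans (\dim (f @: U + <[unitv R i]>))).
  apply: dim_unitv => k; have [y [s [t [Qy cy ->]]]] := units k.
  have [x Px fx] := pullback_onto Qy.
  rewrite memv_add ?rpredZ ?memv_line //.
  rewrite -fx -fx0 opprD addrACA subrr addr0 -linearB memv_img //.
  by apply: AU; split; rewrite ?fx.
apply: leq_trans (dimv_add_leqif _ _) _; apply: leq_add.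
  by rewrite -(limg_ker_dim f U) leq_addl.
by rewrite dim_vline; case: (_ != _).
Qed.

End Pullback.

Section CubeCross.
Variables (R : realType) (V : vectType R).
Implicit Types (P : set V).

Definition sgn (b : bool) : R := if b then 1 else -1.

Lemma sgn_sqr b : sgn b * sgn b = 1.
Proof. by case: b; rewrite /sgn ?mulr1 // mulrNN mulr1. Qed.

Lemma sgn_bound b : -1 <= sgn b <= 1.
Proof. by case: b; rewrite /sgn lexx /= ?andbT; lra. Qed.

Lemma sgn_le b (x : R) : -1 <= x <= 1 -> sgn b * x <= 1.
Proof. by case: b => /andP [H1 H2]; rewrite /sgn; lra. Qed.

Lemma sgn_inj b c : sgn b = sgn c -> b = c.
Proof. by case: b; case: c => //; rewrite /sgn => H; exfalso; lra. Qed.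

Lemma sgn_mul_eq1 b c : sgn b * sgn c = 1 -> b = c.
Proof. by case: b; case: c => //; rewrite /sgn => H; exfalso; lra. Qed.

Section Dim.
Variable d : nat.
Local Notation W := {ffun 'I_d -> R^o}.

(** [sign_sum] defines the vertices of the cube and the facets of the
    cross-polytope; [sign_coord] does the converse. *)
Definition sign_sum (g : {ffun 'I_d -> bool}) : 'Hom(W, R^o) := dotl (fun i => sgn (g i)).
Definition sign_coord (ib : 'I_d * bool) : 'Hom(W, R^o) :=
  dotl (fun i => sgn ib.2 * (i == ib.1)%:R).
Definition sign_vect (g : {ffun 'I_d -> bool}) : W := [ffun i => sgn (g i)].

Lemma sign_coordE i b y : sign_coord (i, b) y = sgn b * y i.
Proof. exact: dot_scaled. Qed.

Lemma sign_vect_cube g : cube R d (sign_vect g).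
Proof. by move=> i; rewrite ffunE sgn_bound. Qed.

Lemma sign_sum_cube g y : cube R d y -> sign_sum g y <= d%:R.
Proof.
move=> cy; rewrite dotlE -[leRHS]mulr1 -[d in leRHS]card_ord mulr_natl -sumr_const.
by apply: ler_sum => i _; exact: sgn_le.
Qed.

Lemma sign_sum_vect g : sign_sum g (sign_vect g) = d%:R.
Proof.
rewrite dotlE; under eq_bigr do rewrite ffunE sgn_sqr.
by rewrite sumr_const card_ord.
Qed.

Lemma sign_sum_cube_eq g y : cube R d y -> sign_sum g y = d%:R -> y = sign_vect g.
Proof.
move=> cy; rewrite dotlE => sy; apply/ffunP => i; rewrite ffunE.
have : \sum_i (1 - sgn (g i) * y i) = 0.
  by rewrite sumrB sumr_const card_ord sy subrr.
move/eqP; rewrite psumr_eq0; last by move=> j _; rewrite subr_ge0 sgn_le.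
move/allP => /(_ i (mem_index_enum i)) /=; rewrite subr_eq0 => /eqP H.
by rewrite -[LHS]mul1r -(sgn_sqr (g i)) -mulrA -H mulr1.
Qed.

Lemma sign_coord_cube ib y : cube R d y -> sign_coord ib y <= 1.
Proof. by case: ib => i b cy; rewrite sign_coordE sgn_le. Qed.

Lemma sign_sum_cross g y : cross_polytope R d y -> sign_sum g y <= 1.
Proof.
move=> /(_ _ (sign_vect_cube g)); rewrite dotlE.
by under eq_bigr do rewrite ffunE.
Qed.

Definition sign_unit i b : W := sgn b *: unitv R i.

Lemma sign_unitE i b k : sign_unit i b k = sgn b * (k == i)%:R.
Proof. by rewrite !ffunE. Qed.

Lemma sign_unit_cross i b : cross_polytope R d (sign_unit i b).
Proof.
move=> x cx; rewrite (bigD1 i) //= big1 => [|k ki].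
  by rewrite sign_unitE eqxx mulr1 addr0 mulrC sgn_le.
by rewrite sign_unitE (negbTE ki) !mulr0.
Qed.

Lemma sign_coord_cross ib y : cross_polytope R d y -> sign_coord ib y <= 1.
Proof.
case: ib => i b cy; rewrite sign_coordE.
have : cube R d (sign_unit i b).
  move=> k; rewrite sign_unitE; have /andP [H1 H2] := sgn_bound b.
  by case: (k == i); rewrite ?mulr1 ?mulr0; lra.
move=> /cy; rewrite (bigD1 i) //= big1 => [|k ki].
  by rewrite sign_unitE eqxx mulr1 addr0.
by rewrite sign_unitE (negbTE ki) mulr0 mul0r.
Qed.

(** A nonzero second coordinate would violate the inequality of the polar for
    the cube point with the signs of [y] at [i] and [k] and zero elsewhere. *)
Lemma sign_coord_cross_eq i b y : cross_polytope R d y ->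
  sign_coord (i, b) y = 1 -> y = sign_unit i b.
Proof.
move=> cy; rewrite sign_coordE => yi; apply/ffunP => k; rewrite sign_unitE.
have [->|ki] := eqVneq k i.
  by rewrite mulr1 -[LHS]mul1r -(sgn_sqr b) -mulrA yi mulr1.
rewrite mulr0; pose x : W := sign_unit i b + sign_unit k (0 <= y k).
have xE j : x j = sgn b * (j == i)%:R + sgn (0 <= y k) * (j == k)%:R.
  by rewrite ffunE !sign_unitE.
have : cube R d x.
  move=> j; rewrite xE; have [->|ji] := eqVneq j i.
    by rewrite eq_sym (negbTE ki) mulr0 addr0 mulr1 sgn_bound.
  by rewrite mulr0 add0r; case: (j == k); rewrite ?mulr1 ?mulr0 ?sgn_bound //; lra.
move=> /cy; rewrite (bigD1 i) //= (bigD1 k) //= big1 => [|j /andP [ji jk]].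
  rewrite !xE !eqxx (negbTE ki) eq_sym (negbTE ki) !mulr1 !mulr0 addr0 add0r addr0 yi /sgn.
  by case: ifPn => [y0|]; [lra|rewrite -ltNge; lra].
by rewrite xE (negbTE ji) (negbTE jk) !mulr0 addr0 mul0r.
Qed.

End Dim.

(** A facet of the cube is tested on one of its corners and the neighbours of
    this corner along the edges of the facet; the differences are multiples of
    coordinate vectors. *)
Lemma faces_of_cube P d : (forall k, finite_set (faces_of_dim k P)) ->
  affine_dim P = d -> (0 < d)%N -> affinely_isomorphic P (cube R d) ->
  (2 ^ d <= nb_faces 0 P)%N /\ (2 * d <= nb_facets P)%N.
Proof.
move=> finP dP d0 [f [b iso]]; split.
  rewrite -[d in (2 ^ d)%N]card_ord -card_bool -card_ffun.
  apply: (pullback_count iso finP (c := @sign_sum d) (beta := fun=> d%:R)).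
  - exact: sign_sum_cube.
  - by move=> g; exists (sign_vect g); [exact: sign_vect_cube|exact: sign_sum_vect].
  - move=> g h /(_ _ (sign_vect_cube g)) [/(_ (sign_sum_vect g)) H _].
    have /ffunP e := sign_sum_cube_eq (sign_vect_cube g) H.
    by apply/ffunP => i; have := e i; rewrite !ffunE => /sgn_inj.
  - move=> g; apply: (pullback_point iso (sign_vect_cube g) (sign_sum_vect g)).
    exact: sign_sum_cube_eq.
have -> : nb_facets P = nb_faces d.-1 P by rewrite /nb_facets dP; case: (d) d0.
have -> : (2 * d)%N = #|{: 'I_d * bool}| by rewrite card_prod card_ord card_bool mulnC.
pose corner (ib : 'I_d * bool) : {ffun 'I_d -> bool} := [ffun k => (k == ib.1) && ib.2].
have cornerE i b' : sign_coord (i, b') (sign_vect (corner (i, b'))) = 1.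
  by rewrite sign_coordE !ffunE eqxx /= sgn_sqr.
apply: (pullback_count iso finP (c := @sign_coord d) (beta := fun=> 1)).
- exact: sign_coord_cube.
- by case=> i b'; exists (sign_vect (corner (i, b'))); [exact: sign_vect_cube|].
- move=> [i b1] [j b2] H.
  pose y : {ffun 'I_d -> R^o} := sign_unit i b1.
  have cy : cube R d y.
    move=> k; rewrite sign_unitE; have /andP [H1 H2] := sgn_bound b1.
    by case: (k == i); rewrite ?mulr1 ?mulr0; lra.
  have [+ _] := H y cy; rewrite !sign_coordE !sign_unitE eqxx mulr1 sgn_sqr => /(_ erefl).
  have [->|ji] := eqVneq j i; last by rewrite !mulr0 => /eqP; rewrite eq_sym oner_eq0.
  by rewrite mulr1 => /sgn_mul_eq1 ->.
- case=> i b'; apply: (pullback_facet iso (i := i) (y0 := sign_vect (corner (i, b')))) => //.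
  + exact: sign_vect_cube.
  + exists (sign_vect (corner (i, ~~ b'))); first exact: sign_vect_cube.
    by rewrite sign_coordE !ffunE eqxx /=; apply/eqP => /sgn_mul_eq1; case: (b').
  + move=> k; have [->|ki] := eqVneq k i.
      exists (sign_vect (corner (i, b'))), 0, 1; split=> //; first exact: sign_vect_cube.
      by rewrite scale0r scale1r add0r.
    pose g := [ffun j => (j == k) || corner (i, b') j].
    exists (sign_vect g), (1 / 2), 0; split; first exact: sign_vect_cube.
      by rewrite sign_coordE !ffunE eq_sym (negbTE ki) eqxx /= sgn_sqr.
    apply/ffunP => j; rewrite !ffunE scale0r addr0 /GRing.scale /=.
    have [->|jk] := eqVneq j k.
      by rewrite (negbTE ki) /sgn /=; lra.
    by rewrite subrr mulr0.
Qed.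

Lemma faces_of_cross P d : (forall k, finite_set (faces_of_dim k P)) ->
  affine_dim P = d -> (0 < d)%N -> affinely_isomorphic P (cross_polytope R d) ->
  (2 * d <= nb_faces 0 P)%N /\ (2 ^ d <= nb_facets P)%N.
Proof.
move=> finP dP d0 [f [b iso]].
have unit_eq (i : 'I_d) b' : sign_coord (i, b') (sign_unit i b') = 1.
  by rewrite sign_coordE sign_unitE eqxx mulr1 sgn_sqr.
have sum_unit g i b' : sign_sum g (@sign_unit d i b') = sgn (g i) * sgn b'.
  rewrite dotlE (bigD1 i) //= big1 => [|k ki]; first by rewrite sign_unitE eqxx mulr1 addr0.
  by rewrite sign_unitE (negbTE ki) !mulr0.
split.
  have -> : (2 * d)%N = #|{: 'I_d * bool}| by rewrite card_prod card_ord card_bool mulnC.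
  apply: (pullback_count iso finP (c := @sign_coord d) (beta := fun=> 1)).
  - exact: sign_coord_cross.
  - by case=> i b'; exists (sign_unit i b'); [exact: sign_unit_cross|].
  - move=> [i b1] [j b2] /(_ _ (sign_unit_cross i b1)) [+ _].
    rewrite !sign_coordE !sign_unitE eqxx mulr1 sgn_sqr => /(_ erefl).
    have [->|ji] := eqVneq j i; last by rewrite !mulr0 => /eqP; rewrite eq_sym oner_eq0.
    by rewrite mulr1 => /sgn_mul_eq1 ->.
  - case=> i b'; apply: (pullback_point iso (sign_unit_cross i b') (unit_eq i b')).
    exact: sign_coord_cross_eq.
have -> : nb_facets P = nb_faces d.-1 P by rewrite /nb_facets dP; case: (d) d0.
rewrite -[d in (2 ^ d)%N]card_ord -card_bool -card_ffun.
pose i0 := Ordinal d0.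
have tight (g : {ffun 'I_d -> bool}) i : sign_sum g (sign_unit i (g i)) = 1.
  by rewrite sum_unit sgn_sqr.
apply: (pullback_count iso finP (c := @sign_sum d) (beta := fun=> 1)).
- exact: sign_sum_cross.
- by move=> g; exists (sign_unit i0 (g i0)); [exact: sign_unit_cross|].
- move=> g h H; apply/ffunP => i.
  have [/(_ (tight g i)) + _] := H _ (sign_unit_cross i (g i)).
  by rewrite sum_unit => /sgn_mul_eq1.
- move=> g; apply: (pullback_facet iso (i := i0) (y0 := sign_unit i0 (g i0))) => //.
  + exact: sign_unit_cross.
  + exists (sign_unit i0 (~~ g i0)); first exact: sign_unit_cross.
    by rewrite sum_unit; apply/eqP => /sgn_mul_eq1; case: (g i0).
  + move=> k; exists (sign_unit k (g k)), (sgn (g k)), (sgn (g k) * sgn (g i0)); split=> //.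
      exact: sign_unit_cross.
    rewrite /sign_unit scalerBr !scalerA sgn_sqr scale1r subrK //.
Qed.

End CubeCross.

Theorem corollary27 (R : realType) (G : mgraph) :
  connected_graph G -> series_parallel G ->
  let P := spanning_tree_polytope R G in
  let d := affine_dim P in
  (nb_faces 0 P * nb_facets P <= d * 2 ^ d.+1)%N /\
  ((nb_faces 0 P * nb_facets P = d * 2 ^ d.+1)%N <->
   affinely_isomorphic P (cube R d) \/
   affinely_isomorphic P (cross_polytope R d)).
Proof.
move=> cG spG P d.
have disj0 (T : {set edge G}) : [disjoint T & (finset.set0 : {set edge G})]%B.
  by apply/pred0P => g /=; rewrite !inE andbF.
have PE : P = hull (@char_vector R (edge G)) (minor_trees finset.set0 finset.set0).
  rewrite /P /spanning_tree_polytope; congr conv; apply/seteqP; split=> x [T [+ ->]].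
    rewrite (spanning_treeE cG) => sT; exists T; split=> //.
    by rewrite inE sT finset.sub0set disj0.
  by rewrite inE => /andP [sT _]; exists T; rewrite (spanning_treeE cG).
have [T0 T0F] : exists T0 : {set edge G}, T0 \in minor_trees finset.set0 finset.set0.
  have [T sT] := tree_exists cG; exists T.
  by rewrite inE sT finset.sub0set disj0.
have facets_le : (nb_facets P <= 2 * d)%N by rewrite /d PE; exact: facet_bound T0F.
have trees_le : (#|minor_trees finset.set0 (finset.set0 : {set edge G})| <= 2 ^ d)%N.
  by rewrite /d PE; exact: vertices_le T0F.
have vertices_trees : (nb_faces 0 P <= #|minor_trees finset.set0 (finset.set0 : {set edge G})|)%N.
  by rewrite PE; exact: nb_vertices_le.
have finP k : finite_set (faces_of_dim k P) by rewrite PE; exact: finite_faces.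
have cubeP : (2 ^ d <= #|minor_trees finset.set0 (finset.set0 : {set edge G})|)%N ->
    affinely_isomorphic P (cube R d).
  by rewrite /d PE; exact: cube_of_vertices T0F.
have bound : (nb_faces 0 P * nb_facets P <= 2 ^ d * (2 * d))%N.
  by apply: leq_mul => //; exact: leq_trans trees_le.
have -> : (d * 2 ^ d.+1 = 2 ^ d * (2 * d))%N by rewrite expnS mulnA [RHS]mulnC (mulnC 2 d).
split=> //; have [d0|dpos] := posnP d.
  split=> _; last by rewrite /nb_facets -/d d0 !muln0.
  by left; apply: cubeP; rewrite d0; apply/card_gt0P; exists T0.
split=> [eqb|].
  left; apply: cubeP; apply: leq_trans vertices_trees.
  rewrite -(leq_pmul2r (m := 2 * d)) ?muln_gt0 //.
  by rewrite -eqb leq_mul2l facets_le orbT.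
move=> iso; apply/eqP; rewrite eqn_leq bound /=; case: iso => iso.
  by have [H1 H2] := faces_of_cube finP erefl dpos iso; apply: leq_mul.
have [H1 H2] := faces_of_cross finP erefl dpos iso.
(* The [2 ^ d] facets obey the facet bound, so [d] is 1 or 2. *)
have e2 : (2 ^ d = 2 * d)%N.
  have := leq_trans H2 facets_le; rewrite -/d.
  move: (d) dpos => [//|[//|[//|n]]] _.
  have lt : (n.+3 < 2 ^ n.+2)%N.
    by elim: n => // n IH; rewrite expnS mul2n -addnn -addn1 leq_add // expn_gt0.
  by rewrite expnS leq_pmul2l // leqNgt lt.
by apply: leq_mul; rewrite ?e2 // -e2.
Qed.
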